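(* Let $q$ be a prime power, $u\in\mathbb{F}_q^\times$, and let $X_u$ be the curve over $\mathbb{F}_q$ in $\mathbb{P}^2$ defined by $y_1^3+y_2^3+y_3^3-3u^{-1}y_1y_2y_3=0$. (1) If $q\equiv2\pmod3$, then $$\#X_u(\mathbb{F}_q)=q+1-F_q\big((\tfrac13,\tfrac23)\,;(1,1)\mid u^3\big).$$ (2) If $q\equiv1\pmod3$, then $$\#X_u(\mathbb{F}_q)=q+1-F_q\big((\tfrac13,\tfrac23)\,;(1,1)\mid u^3\big)-2q\,F_q(\emptyset\,;\emptyset\mid u^3)$$ $$=q+1-F_q\big((\tfrac13,\tfrac23)\,;(1,1)\mid u^3\big)-2q\cdot\begin{cases}-1&\text{if }u^3=1,\\0&\text{if }u^3\ne1.\end{cases}$$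
   Context: Put $q^\times=q-1$. Fix a non-trivial additive character $\psi:\mathbb{F}_q\to\mathbb{C}^\times$ and a multiplicative character $\chi:\mathbb{F}_q^\times\to\mathbb{C}^\times$ of order $q^\times$; $\chi^m(x)=\chi(x)^m$, $\zeta_k=e^{2\pi i/k}$. The Gauss sum is $g(m)=\sum_{u\in\mathbb{F}_q^\times}\psi(u)\chi^m(u)$, and $g(v)=\prod_ig(v_i)$ for an integer vector $v$. Hypergeometric parameters $(\alpha\,;\beta)$ are vectors $\alpha,\beta\in\mathbb{Q}^n$ ($n\ge0$; $(\emptyset;\emptyset)$ for $n=0$) with $\alpha_i-\beta_j\notin\mathbb{Z}$ for all $i,j$. If $q^\times\alpha,q^\times\beta\in\mathbb{Z}^n$, then for $t\in\mathbb{F}_q^\times$ $$F_q(\alpha\,;\beta\mid t)=\frac{1}{1-q}\sum_{m=0}^{q^\times-1}\prod_{i=1}^n\frac{g(m+\alpha_iq^\times)\,g(-m-\beta_iq^\times)}{g(\alpha_iq^\times)\,g(-\beta_iq^\times)}\;\chi((-1)^nt)^m.$$ Extension to other $q$: a gamma triple $(\gamma,\delta,N)$ consists of $\gamma\in\mathbb{Z}^{d+2}$ with all components non-zero, $\sum_j\gamma_j=0$, $\gcd_j(\gamma_j)=1$; a vector $\delta\in\mathbb{Z}^{d+2}$; and a positive integer $N$. It represents $(\alpha\,;\beta)$ if $\prod_j(T-e^{2\pi i\alpha_j})/\prod_j(T-e^{2\pi i\beta_j})=\prod_{\gamma_j<0}(T^{-\gamma_j}-\zeta_N^{\delta_j})/\prod_{\gamma_j>0}(T^{\gamma_j}-\zeta_N^{-\delta_j})$.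 Let $s_\delta(m)$ be the multiplicity of $e^{2\pi im/q^\times}$ as a zero of the greatest common divisor of the numerator and denominator of the latter quotient. If $q$ is coprime to all $\gamma_j$ and $N\mid q^\times$, set $$F_q(\gamma,\delta,N\mid t)=\frac{1}{1-q}\sum_{m=0}^{q^\times-1}\frac{g\left(-\gamma m+\frac{\delta}{N}q^\times\right)}{g\left(\frac{\delta}{N}q^\times\right)}\,q^{s_\delta(-m)-s_\delta(0)}\,\chi^m(\gamma^\gamma t),\qquad\gamma^\gamma=\prod_j\gamma_j^{\gamma_j}.$$ Then $F_q(\alpha\,;\beta\mid t)$ is by definition $F_q(\gamma,\delta,N\mid t)$ for any gamma triple representing $(\alpha\,;\beta)$ which is defined at $q$ (this is independent of the triple and agrees with the first formula when $q^\times\alpha,q^\times\beta$ are integral). For example $((\tfrac13,\tfrac23)\,;(1,1))$ is represented by $((-3,1,1,1),(0,0,0,0),1)$, so its sum is defined for all $q$ coprime to $3$. *)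

(* Defs.v *)
From mathcomp Require Import all_boot all_order all_algebra.
From mathcomp Require Import complex.
From mathcomp Require Import boolp classical_sets reals trigo.

Set Implicit Arguments.
Unset Strict Implicit.
Unset Printing Implicit Defensive.

Import Order.TTheory GRing.Theory Num.Theory.
Local Open Scope ring_scope.
Local Open Scope complex_scope.

(* e^{2 pi i a} for rational a *)
Definition e2pi (R : realType) (a : rat) : R[i] :=
  cos (2 * pi * ratr a) +i* sin (2 * pi * ratr a).

Definition nontrivial_add_char (R : realType) (F : finFieldType)
    (psi : F -> R[i]) : Prop :=
  [/\ psi 0 = 1, {morph psi : x y / x + y >-> x * y} & exists x, psi x != 1].

(* Multiplicative characters are functions on F of which only the values on
   F^* are constrained and used; chi^m is x |-> (chi x) ^ m. *)
Definition mult_char (R : realType) (F : finFieldType)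
    (chi : F -> R[i]) : Prop :=
  chi 1 = 1 /\ forall x y, x != 0 -> y != 0 -> chi (x * y) = chi x * chi y.

Definition mult_char_order (R : realType) (F : finFieldType)
    (chi : F -> R[i]) (k : nat) : Prop :=
  (0 < k)%N /\
  forall m : nat, (forall x, x != 0 -> chi x ^+ m = 1) <-> (k %| m)%N.

Record gamma_triple := GammaTriple {
  gt_d : nat;
  gt_gamma : (gt_d.+2).-tuple int;
  gt_delta : (gt_d.+2).-tuple int;
  gt_N : nat }.

Definition gamma_triple_wf (G : gamma_triple) : Prop :=
  [/\ forall j, tnth (gt_gamma G) j != 0,
      \sum_j tnth (gt_gamma G) j = 0,
      \big[gcdn/0%N]_j `|tnth (gt_gamma G) j|%N = 1%N
    & (0 < gt_N G)%N].

Section GammaTriplePolynomials.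
Variables (R : realType) (G : gamma_triple).
Let gam j := tnth (gt_gamma G) j.
Let del j := tnth (gt_delta G) j.
Let zetaN : R[i] := e2pi R (gt_N G)%:R^-1.

Definition gt_num : {poly R[i]} :=
  \prod_(j | gam j < 0) ('X^(`|gam j|%N) - (zetaN ^ del j)%:P).

Definition gt_den : {poly R[i]} :=
  \prod_(j | 0 < gam j) ('X^(`|gam j|%N) - (zetaN ^ (- del j))%:P).

Local Notation "p %:F" := (@FracField.tofrac {poly R[i]} p) : ring_scope.

Definition gt_represents n (alpha beta : n.-tuple rat) : Prop :=
  (\prod_(a <- alpha) ('X - (e2pi R a)%:P))%:F /
    (\prod_(b <- beta) ('X - (e2pi R b)%:P))%:F
  = gt_num%:F / gt_den%:F :> {fraction {poly R[i]}}.

(* s_delta(m), depending on q through the evaluation point e^{2 pi i m/(q-1)} *)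
Definition gt_mult (q : nat) (m : int) : nat :=
  mup (e2pi R (m%:~R / q.-1%:R)) (gcdp gt_num gt_den).

Definition gt_defined_at (q : nat) : Prop :=
  (forall j, coprime q `|gam j|%N) /\ (gt_N G %| q.-1)%N.

End GammaTriplePolynomials.

Section HypergeometricSums.
Variables (R : realType) (F : finFieldType) (psi chi : F -> R[i]).
Let C := R[i].
Let q := #|F|.

Definition gauss (m : int) : C := \sum_(u : F | u != 0) psi u * chi u ^ m.

Definition hyp_integral n (alpha beta : n.-tuple rat) : bool :=
  all (fun a : rat => q.-1%:R * a \is a Num.int) alpha &&
  all (fun b : rat => q.-1%:R * b \is a Num.int) beta.

(* The floor is only a cast from rat to int here: the formula is used when
   (q - 1) alpha and (q - 1) beta are integral. *)
Definition hyp_sum_integral n (alpha beta : n.-tuple rat) (t : F) : C :=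
  let A i := Num.floor (q.-1%:R * tnth alpha i) in
  let B i := Num.floor (q.-1%:R * tnth beta i) in
  (1 - q%:R)^-1 *
  \sum_(m < q.-1)
    (\prod_(i < n) ((gauss (m%:Z + A i) * gauss (- m%:Z - B i)) /
                    (gauss (A i) * gauss (- B i)))) *
    chi ((-1) ^+ n * t) ^+ m.

Definition hyp_sum_gamma (G : gamma_triple) (t : F) : C :=
  let gam j := tnth (gt_gamma G) j in
  let shift j := tnth (gt_delta G) j * (q.-1 %/ gt_N G)%N%:Z in
  let s := gt_mult R G q in
  (1 - q%:R)^-1 *
  \sum_(m < q.-1)
    (\prod_j gauss (- gam j * m%:Z + shift j)) / (\prod_j gauss (shift j)) *
    q%:R ^ ((s (- m%:Z))%:Z - (s 0)%:Z) *
    chi ((\prod_j (gam j)%:~R ^ gam j) * t) ^+ m.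

Definition usable_triple n (alpha beta : n.-tuple rat) (G : gamma_triple) :
    Prop :=
  [/\ gamma_triple_wf G, gt_represents R G alpha beta & gt_defined_at G q].

(* hyp_sum_gamma takes the same value on all usable triples of
   (alpha; beta).  The representative used to define the sum is one with N
   least and then with gamma shortest; it exists as soon as there is a usable
   triple. *)
Definition simplest_triple n (alpha beta : n.-tuple rat) (G : gamma_triple) :
    Prop :=
  usable_triple alpha beta G /\
  forall G', usable_triple alpha beta G' ->
    (gt_N G < gt_N G')%N \/ (gt_N G = gt_N G' /\ (gt_d G <= gt_d G')%N).

(* F_q(alpha; beta | t) for t != 0, meaningful when no alpha_i - beta_j is an
   integer; the value is 0 when there is neither a q-integral formula nor a
   usable gamma triple. *)
Definition hyp_sum n (alpha beta : n.-tuple rat) (t : F) : C :=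
  if hyp_integral alpha beta then hyp_sum_integral alpha beta t
  else xget 0 [set hyp_sum_gamma G t | G in simplest_triple alpha beta]%classic.

End HypergeometricSums.

Section HesseCubic.
Variable F : finFieldType.

(* A point of P^2(F), as the set of nonzero vectors of a line of F^3. *)
Definition proj_pt (y : 'rV[F]_3) : {set 'rV[F]_3} :=
  [set c *: y | c : F & c != 0].

Definition hesse_cubic (u : F) (y : 'rV[F]_3) : F :=
  y 0 0 ^+ 3 + y 0 1 ^+ 3 + y 0 2 ^+ 3 - 3 * u^-1 * y 0 0 * y 0 1 * y 0 2.

Definition hesse_points (u : F) : {set {set 'rV[F]_3}} :=
  [set proj_pt y | y : 'rV[F]_3 & (y != 0) && (hesse_cubic u y == 0)].

End HesseCubic.

(* Main.v *)
Require Import Defs.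
From mathcomp Require Import all_boot all_order all_algebra fingroup cyclic finfield.
From mathcomp Require Import complex ring lra zify.
From mathcomp Require Import boolp classical_sets reals trigo.

Set Implicit Arguments.
Unset Strict Implicit.
Unset Printing Implicit Defensive.

Import Order.TTheory GRing.Theory Num.Theory.
Local Open Scope ring_scope.
Local Open Scope complex_scope.

(** Write q for the number of elements of F and g(m) for the Gauss sums.

    Counting points.  The Hesse cubic meets each of the three coordinate lines
    in the points given by the cube roots of -1.  Away from these lines, a point
    (a : b : 1) is sent by x = a^3, y = b^3 to the curve
    27 x y = u^3 (1 + x + y)^3, and the fibre over (x, y) has as many points as
    x has cube roots.  The number of cube roots of x is the sum of chi^e(x) over
    the characters chi^e whose cube is trivial, so the point count is a
    combination of the sums [curve_sum e (u^3)] of chi^e(x) over that curve.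
    Detecting its equation by additive and multiplicative characters gives
    [curve_sum_gauss]: up to a factor and an elementary term, these are the sums over m
    of chi^m(-u^3/27) g(e-m) g(-m) g(-m-e) g(3m).  For e = 0 this is the
    hypergeometric sum of the gamma triple ((-3,1,1,1), 0, 1)
    ([curve_sum_untwisted]).

    If q = 2 mod 3, only e = 0 occurs.  The hypergeometric sum is computed from
    a gamma triple with N = 1 and gamma as short as possible; comparing orders of
    vanishing at suitable roots of unity shows that gamma must be a permutation
    of (-3,1,1,1) ([level1_shortest]).

    If q = 1 mod 3, put k = (q-1)/3; then e takes the values 0, k and -k.  The
    main tool is the Hasse-Davenport product formula for the characters of
    order 3, [hasse_davenport_cubic].  It turns the sum for e = 0 into the
    q-integral formula for the hypergeometric sum ([hyp_sum_one_mod_three]), and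
    it turns the sums for e = k and e = -k into sums of g(3m) g(-3m), which the
    reflection formula evaluates ([curve_sum_twisted]); these produce the term
    2 q [u^3 = 1].

    The product formula itself follows from the case of equality of the
    Cauchy-Schwarz inequality.  Its two sides H(m) and D(m) have the same
    absolute value, so they agree for all m as soon as the sum of H(m) times the
    conjugate of D(m) equals the sum of |D(m)|^2.  By [curve_sum_gauss], the
    former sum is a multiple of [curve_sum k 1].  At t = 1 the curve is a nodal
    cubic, parametrised by a |-> (a^3, -(1+a)^3); all its points have a cube as
    first coordinate, so this twisted sum just counts its q - 3 points
    ([curve_sum_nodal]). *)

(** * Points of the Hesse cubic *)

Section HessePoints.
Variable F : finFieldType.
Implicit Types (u a b c : F) (y z : 'rV[F]_3).

Lemma proj_pt_scale c y : c != 0 -> proj_pt (c *: y) = proj_pt y.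
Proof.
move=> c0; apply/setP => z; apply/imsetP/imsetP => [] [d]; rewrite inE => d0 ->.
  by exists (d * c); rewrite ?scalerA // inE mulf_neq0.
by exists (d / c); rewrite ?scalerA ?divfK // inE mulf_neq0 ?invr_neq0.
Qed.

Lemma proj_pt_eq y z : proj_pt y = proj_pt z -> exists c, y = c *: z.
Proof.
move=> yz; have : y \in proj_pt y.
  by apply/imsetP; exists 1; rewrite ?scale1r // inE oner_neq0.
by rewrite yz => /imsetP [c _ ->]; exists c.
Qed.

Definition vec3 a b c : 'rV[F]_3 := \row_i [:: a; b; c]`_i.

Lemma vec3E y : y = vec3 (y 0 0) (y 0 1) (y 0 2).
Proof.
apply/rowP => -[[|[|[|i]]] hi] //; rewrite !mxE /=; congr (y _ _); exact: val_inj.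
Qed.

Lemma scale_vec3 d a b c : d *: vec3 a b c = vec3 (d * a) (d * b) (d * c).
Proof. by apply/rowP => -[[|[|[|i]]] hi] //; rewrite !mxE. Qed.

Lemma vec3_inj a b c a' b' c' : vec3 a b c = vec3 a' b' c' -> [/\ a = a', b = b' & c = c'].
Proof. by move=> /rowP h; have := (h 0, h 1, h 2); rewrite !mxE /= => -[[]]. Qed.

Lemma hesse_cubic_vec3 u a b c :
  hesse_cubic u (vec3 a b c) = a ^+ 3 + b ^+ 3 + c ^+ 3 - 3 * u^-1 * a * b * c.
Proof. by rewrite /hesse_cubic !mxE. Qed.

(** Off the line c = 0, a point is normalised by c = 1; on that line the cubic
    restricts to a^3 + b^3, so that b cannot vanish and is normalised to 1. *)
Lemma hesse_points_charts u : hesse_points u =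
  [set proj_pt (vec3 p.1 p.2 1) | p : F * F &
     p.1 ^+ 3 + p.2 ^+ 3 + 1 == 3 * u^-1 * p.1 * p.2]
  :|: [set proj_pt (vec3 a 1 0) | a : F & a ^+ 3 == -1].
Proof.
apply/setP => P; apply/imsetP/setUP => [[y]|[] /imsetP].
- rewrite inE (vec3E y) hesse_cubic_vec3.
  move: (y 0 0) (y 0 1) (y 0 2) => a b c /andP [y0 /eqP cubic] ->.
  have [c0|c0] := eqVneq c 0; [right|left]; apply/imsetP.
    rewrite c0 in y0 cubic *; have b0 : b != 0.
      apply: contra y0 => /eqP b0; rewrite b0 in cubic *.
      have /eqP : a ^+ 3 = 0 by rewrite -cubic; ring.
      rewrite expf_eq0 /= => /eqP ->; apply/eqP.
      by rewrite -(scale0r (vec3 0 0 0)) scale_vec3 !mulr0.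
    exists (a / b).
      rewrite inE -subr_eq0 opprK; apply/eqP; apply: (mulIf (expf_neq0 3 b0)).
      by rewrite mul0r -[RHS]cubic mulrDl expr_div_n divfK ?expf_neq0 //; ring.
    by rewrite -[RHS](proj_pt_scale _ b0) scale_vec3 mulrCA divff // !mulr1 mulr0.
  exists (a / c, b / c).
    rewrite inE /= -subr_eq0; apply/eqP; apply: (mulIf (expf_neq0 3 c0)).
    by rewrite mul0r -[RHS]cubic; move: (u^-1) => v; field.
  by rewrite -[RHS](proj_pt_scale _ c0) scale_vec3 /= mulrCA divff // mulrCA divff // !mulr1.
- case=> -[a b]; rewrite inE /= => /eqP cubic ->.
  exists (vec3 a b 1) => //; rewrite inE hesse_cubic_vec3 expr1n cubic mulr1 subrr eqxx andbT.
  apply: contra_neq (oner_neq0 F) => /rowP /(_ (2 : 'I_3)).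
  by rewrite !mxE.
case=> a; rewrite inE => /eqP cubic ->.
exists (vec3 a 1 0) => //; rewrite inE hesse_cubic_vec3 cubic expr1n expr0n mulr0.
rewrite addNr add0r subrr eqxx andbT.
by apply: contra_neq (oner_neq0 F) => /rowP /(_ (1 : 'I_3)); rewrite !mxE.
Qed.

Lemma card_sum_bool (T : finType) (P : pred T) : #|P| = (\sum_x P x)%N.
Proof. by rewrite -sum1_card big_mkcond; apply: eq_bigr => x _; rewrite unfold_in; case: (P x). Qed.

Definition on_hesse u : rel F := fun a b => a ^+ 3 + b ^+ 3 + 1 == 3 * u^-1 * a * b.

(** Each of the three coordinate lines meets the cubic in the points given by
    the cube roots of -1, and no point lies on two of these lines. *)
Lemma card_hesse_points u : #|hesse_points u| =
  (\sum_(a | (a != 0)%R) \sum_(b | (b != 0)%R) on_hesse u a b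
   + 3 * #|[pred a : F | (a ^+ 3 == -1)%R]|)%N.
Proof.
rewrite hesse_points_charts cardsU.
rewrite card_in_imset => [|[a b] [a' b'] _ _ /= /proj_pt_eq [c]]; last first.
  rewrite scale_vec3 => /vec3_inj [-> -> ]; rewrite mulr1 => <-.
  by rewrite !mul1r.
rewrite card_in_imset => [|a a' _ _ /= /proj_pt_eq [c]]; last first.
  by rewrite scale_vec3 => /vec3_inj [-> ]; rewrite mulr1 => <-; rewrite !mul1r.
rewrite [X in (_ - X)%N](_ : _ = 0%N) ?subn0; last first.
  apply/eqP; rewrite cards_eq0 -finset.subset0; apply/fintype.subsetP => P.
  rewrite inE => /andP [/imsetP [[a b] _ ->] /imsetP [a' _ /proj_pt_eq [c]]].
  rewrite scale_vec3 => /vec3_inj [_ _ /eqP].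
  by rewrite mulr0 oner_eq0.
rewrite !cardsE !card_sum_bool /=; set N := (\sum_(a : F) (_ == -1)%R)%N.
have on_axis (a : F) : (a ^+ 3 + 1 == 0) = (a ^+ 3 == -1) by rewrite addr_eq0.
rewrite -(pair_bigA _ (fun a b => nat_of_bool (on_hesse u a b))) /=.
rewrite (bigD1 0) //=.
have -> : (\sum_b on_hesse u 0%R b)%N = N.
  by apply: eq_bigr => b _; rewrite /on_hesse expr0n add0r mulr0 mul0r on_axis.
under eq_bigr => a a0.
  rewrite (bigD1 0) //= [on_hesse u a 0]/on_hesse expr0n addr0 mulr0 on_axis.
  over.
rewrite big_split /=.
have -> : (\sum_(a : F | (a != 0)%R) (a ^+ 3 == -1)%R)%N = N.
  by rewrite /N [RHS](bigD1 0) //= expr0n eq_sym oppr_eq0 oner_eq0 add0n.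
by rewrite !mulSn mul0n addn0; lia.
Qed.

(** The inverse of b |-> b^3 is read off from 3 a b = u (1 + a^3 + b^3). *)
Lemma hesse_fibre u a : 3 != 0 :> F -> u != 0 -> a != 0 ->
  (\sum_(b | (b != 0)%R) on_hesse u a b =
   \sum_(y : F | ((y != 0) && (27 * a ^+ 3 * y == u ^+ 3 * (1 + a ^+ 3 + y) ^+ 3))%R) 1)%N.
Proof.
move=> three0 u0 a0; have a30 : 3 * a != 0 by rewrite mulf_neq0.
rewrite -big_mkcondr [RHS](reindex_onto (fun b => b ^+ 3)
  (fun y : F => u * (1 + a ^+ 3 + y) / (3 * a))) /=; last first.
  move=> y /andP [_ /eqP curve]; apply: (mulfI (expf_neq0 3 a30)).
  by rewrite -exprMn mulrCA divff // mulr1 exprMn -curve; ring.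
apply: eq_bigl => b; rewrite expf_eq0 /= -andbA; congr (_ && _).
have -> : on_hesse u a b = (u * (1 + a ^+ 3 + b ^+ 3) / (3 * a) == b).
  rewrite /on_hesse -(inj_eq (mulfI u0)) -[RHS](inj_eq (mulIf a30)) divfK //.
  by congr (_ == _); [ring | field].
apply/idP/andP => [h|[]//]; split=> //.
apply/eqP; rewrite -exprMn.
rewrite -[u * _](divfK a30) (eqP h); ring.
Qed.

(** The map is (a, b) |-> (a^3, b^3).  A point of the fibre over (x, y) amounts
    to a cube root a of x, since the equation of the cubic gives back b. *)
Lemma hesse_torus_count u : 3 != 0 :> F -> u != 0 ->
  (\sum_(a | (a != 0)%R) \sum_(b | (b != 0)%R) on_hesse u a b =
   \sum_(x | (x != 0)%R)
     \sum_(y : F | ((y != 0) && (27 * x * y == u ^+ 3 * (1 + x + y) ^+ 3))%R)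
       #|[pred a : F | (a ^+ 3 == x)%R]|)%N.
Proof.
move=> three0 u0; rewrite (eq_bigr _ (fun a => @hesse_fibre u a three0 u0)).
rewrite (partition_big (fun a => a ^+ 3) (fun x => x != 0)) /=; last first.
  by move=> a a0; rewrite expf_neq0.
apply: eq_bigr => x x0; under eq_bigr => a /andP [_ /eqP ->] do over.
rewrite exchange_big /=; apply: eq_bigr => y _.
rewrite sum1_card; apply: eq_card => a; rewrite unfold_in /=.
by case: (eqVneq a 0) => [->|] //=; rewrite inE expr0n eq_sym (negPf x0).
Qed.

End HessePoints.

(** * Multiplicities of roots of unity *)

Section Multiplicity.
Variable K : numFieldType.

Lemma XnsubC1_neq0 n : (0 < n)%N -> 'X^n - 1 != 0 :> {poly K}.
Proof. by move=> n0; rewrite -size_poly_eq0 -polyC1 size_XnsubC. Qed.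

(** In characteristic 0 the polynomial X^n - 1 is prime to its derivative. *)
Lemma mup_XnsubC1 (z : K) n : (0 < n)%N -> mup z ('X^n - 1) = (z ^+ n == 1).
Proof.
move=> n0; have rootE : root ('X^n - 1) z = (z ^+ n == 1).
  by rewrite rootE !hornerE subr_eq0.
case: eqVneq => zn; last by rewrite mupNroot // rootE.
apply/eqP; rewrite eqn_leq mup_leq ?mup_geq ?XnsubC1_neq0 // expr1.
rewrite dvdp_XsubCl rootE zn eqxx andbT; apply/negP => /dvdpP [r def_r].
have : ('X^n - 1)^`().[z] = 0.
  by rewrite def_r expr2 !derivE !hornerE /=; ring.
rewrite derivB derivXn -polyC1 derivC subr0 hornerMn hornerXn => /eqP.
rewrite mulrn_eq0 -[_ == 0%N]negbK -lt0n n0 /=.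
apply/negP; rewrite expf_neq0 //; apply: contra_eq_neq zn => ->.
by rewrite expr0n -[_ == 0%N]negbK -lt0n n0 eq_sym oner_eq0.
Qed.

Lemma mup_prod (I : finType) (P : pred I) (f : I -> {poly K}) (z : K) :
  (forall i, P i -> f i != 0) ->
  mup z (\prod_(i | P i) f i) = (\sum_(i | P i) mup z (f i))%N.
Proof.
move=> f0; suff [] : \prod_(i | P i) f i != 0 /\
    mup z (\prod_(i | P i) f i) = (\sum_(i | P i) mup z (f i))%N by [].
elim/big_rec2: _ => [|i m p Pi [p0 mp]].
  by rewrite oner_neq0 mupNroot // root1.
by rewrite mulf_neq0 ?f0 // mupM ?f0 // mp.
Qed.

Lemma mup_gcd_cubic (z : K) :
  mup z (gcdp ('X^3 - 1) (('X - 1) ^+ 3)) = (z == 1).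
Proof.
have X31 : 'X^3 - 1 != 0 :> {poly K} by rewrite XnsubC1_neq0.
case: eqVneq => z1; last first.
  rewrite mupNroot // root_gcd negb_and; apply/orP; right.
  by rewrite rootE !hornerE expf_eq0 subr_eq0.
have gcd0 : gcdp ('X^3 - 1) (('X - 1) ^+ 3) != 0 :> {poly K}.
  by rewrite gcdp_eq0 negb_and X31.
apply/eqP; rewrite eqn_leq mup_leq // mup_geq // expr1 z1; apply/andP; split.
  apply/negP => /dvdp_trans /(_ (dvdp_gcdl _ _)).
  by rewrite -mup_geq // mup_XnsubC1 // expr1n eqxx.
rewrite dvdp_gcd dvdp_XsubCl rootE !hornerE expr1n subrr eqxx /=.
by rewrite polyC1 dvdp_exp.
Qed.

Lemma cyclotomic3_ratio (w : K) : w ^+ 3 = 1 -> w != 1 ->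
  ('X - w%:P) * ('X - (w ^+ 2)%:P) * ('X - 1) ^+ 3 =
  ('X^3 - 1) * (('X - 1%:P) * ('X - 1%:P)).
Proof.
move=> w3 w1; have w_quad : w ^+ 2 = - 1 - w.
  have : (w - 1) * (w ^+ 2 + w + 1) = 0 by rewrite -[RHS](subrr 1) -{3}w3; ring.
  move/eqP; rewrite mulf_eq0 subr_eq0 (negPf w1) => /eqP w0.
  by rewrite -[RHS]add0r -w0; ring.
have -> : ('X - w%:P) * ('X - (w ^+ 2)%:P) = 'X^2 - (w + w ^+ 2) *: 'X + (w ^+ 3)%:P.
  by rewrite -mul_polyC !polyCD !polyC_exp; ring.
by rewrite w3 w_quad addrCA subrr addr0 scaleN1r opprK polyC1; ring.
Qed.

End Multiplicity.

Section RootsOfUnity.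
Variable R : realType.
Local Notation e := (e2pi R).

Lemma e2piD a b : e (a + b) = e a * e b.
Proof.
rewrite /e2pi rmorphD mulrDr cosD sinD.
by apply/eqP; rewrite eq_complex /= eqxx /= addrC.
Qed.

Lemma e2pi0 : e 0 = 1.
Proof. by rewrite /e2pi rmorph0 mulr0 cos0 sin0. Qed.

Lemma e2pi1 : e 1 = 1.
Proof. by rewrite /e2pi rmorph1 mulr1 mulr_natl cos2pi sin2pi. Qed.

Lemma e2piMn a n : e (a *+ n) = e a ^+ n.
Proof.
elim: n => [|n IH]; first by rewrite mulr0n e2pi0.
by rewrite mulrS e2piD IH exprS.
Qed.

Lemma e2pi_neq1 a : 0 < a < 1 -> e a != 1.
Proof.
case/andP=> a0 a1; rewrite eq_complex /= negb_and; apply/orP; left.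
rewrite -mulrA mulr_natl cos_mulr2n cos2sin2.
have s0 : 0 < sin (pi * ratr a) :> R.
  apply: sin_gt0_pi; have p0 := pi_gt0 R.
  by rewrite mulr_gt0 ?ltr0q //= gtr_pMr // -(rmorph1 (@ratr R)) ltr_rat.
have : 0 < sin (pi * ratr a) ^+ 2 :> R by rewrite exprn_gt0.
by move=> ?; apply/eqP; lra.
Qed.

Lemma e2piN_neq1 a : 0 < a < 1 -> e (- a) != 1.
Proof.
move=> /e2pi_neq1; apply: contra_neq => ea.
by rewrite -[LHS]mulr1 -ea -e2piD addrN e2pi0.
Qed.

Lemma e2piV_exp n : (0 < n)%N -> e n%:R^-1 ^+ n = 1.
Proof.
by move=> n0; rewrite -e2piMn -(mulr_natl n%:R^-1) divff ?e2pi1 // pnatr_eq0 -lt0n.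
Qed.

Lemma e2piV_exp_neq1 n i : (0 < i < n)%N -> e n%:R^-1 ^+ i != 1.
Proof.
case/andP=> i0 i_n; have n0 : (0 < n)%N by apply: leq_trans i_n.
rewrite -e2piMn -(mulr_natl n%:R^-1); apply: e2pi_neq1.
by rewrite divr_gt0 ?ltr0n // ltr_pdivrMr ?ltr0n // mul1r ltr_nat.
Qed.

End RootsOfUnity.

(** * Gamma triples with N = 1 representing (1/3, 2/3; 1, 1) *)

Section CubicTriple.
Variable R : realType.
Local Notation C := R[i].
Local Notation e := (e2pi R).
Local Notation alpha := [tuple 1 / 3; 2 / 3 : rat].
Local Notation beta := [tuple 1; 1 : rat].
Local Notation gam G j := (tnth (gt_gamma G) j).

Section LevelOne.
Variable G : gamma_triple.
Hypothesis N1 : gt_N G = 1%N.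

Lemma gt_num_level1 : gt_num R G = \prod_(j | gam G j < 0) ('X^(`|gam G j|%N) - 1).
Proof. by apply: eq_bigr => j _; rewrite N1 invr1 e2pi1 exp1rz. Qed.

Lemma gt_den_level1 : gt_den R G = \prod_(j | 0 < gam G j) ('X^(`|gam G j|%N) - 1).
Proof. by apply: eq_bigr => j _; rewrite N1 invr1 e2pi1 exp1rz. Qed.

Let neg_factor_neq0 j : gam G j < 0 -> 'X^(`|gam G j|%N) - 1 != 0 :> {poly C}.
Proof. by move=> gj; rewrite XnsubC1_neq0 // absz_gt0 ltr0_neq0. Qed.

Let pos_factor_neq0 j : 0 < gam G j -> 'X^(`|gam G j|%N) - 1 != 0 :> {poly C}.
Proof. by move=> gj; rewrite XnsubC1_neq0 // absz_gt0 lt0r_neq0. Qed.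

Lemma gt_num_level1_neq0 : gt_num R G != 0.
Proof. by rewrite gt_num_level1; apply/prodf_neq0 => j; apply: neg_factor_neq0. Qed.

Lemma gt_den_level1_neq0 : gt_den R G != 0.
Proof. by rewrite gt_den_level1; apply/prodf_neq0 => j; apply: pos_factor_neq0. Qed.

Lemma mup_gt_num z : mup z (gt_num R G) = (\sum_(j | (gam G j < 0)%R) (z ^+ `|gam G j| == 1)%R)%N.
Proof.
rewrite gt_num_level1 mup_prod => [|j]; last exact: neg_factor_neq0.
by apply: eq_bigr => j gj; rewrite mup_XnsubC1 // absz_gt0 ltr0_neq0.
Qed.

Lemma mup_gt_den z : mup z (gt_den R G) = (\sum_(j | (0 < gam G j)%R) (z ^+ `|gam G j| == 1)%R)%N.
Proof.
rewrite gt_den_level1 mup_prod => [|j]; last exact: pos_factor_neq0.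
by apply: eq_bigr => j gj; rewrite mup_XnsubC1 // absz_gt0 lt0r_neq0.
Qed.

(** At N = 1 all factors are T^n - 1, so an equality of rational functions is an
    equality of orders of vanishing at each root of unity; these are the
    conditions on gamma that the sequel evaluates at well-chosen points z. *)
Lemma gt_represents_mup : gt_represents R G alpha beta -> forall z : C,
  ((e (1 / 3)%R == z) + (e (2 / 3)%R == z) + mup z (gt_den R G) =
   mup z (gt_num R G) + 2 * (z == 1%R))%N.
Proof.
move=> rep z; set A : {poly C} := \prod_(a <- alpha) ('X - (e a)%:P).
set B : {poly C} := \prod_(b <- beta) ('X - (e b)%:P).
have B0 : B != 0 by rewrite monic_neq0 // monic_prod_XsubC.
have A0 : A != 0 by rewrite monic_neq0 // monic_prod_XsubC.
have : A * gt_den R G = gt_num R G * B.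
  apply/eqP; rewrite -tofrac_eq !tofracM -eqr_div ?tofrac_eq0 ?gt_den_level1_neq0 //.
  exact/eqP.
move/(congr1 (mup z)); rewrite !mupM ?gt_den_level1_neq0 ?gt_num_level1_neq0 //.
have mupXsubC y : mup z ('X - y%:P) = (y == z) :> nat.
  by rewrite -[_ - _]expr1 mup_XsubCX; case: (y == z).
rewrite /A /B !big_cons !big_nil !mulr1 !mupM ?polyXsubC_eq0 // !mupXsubC.
by rewrite e2pi1 (eq_sym 1 z) mul2n addnn => ->.
Qed.

Hypotheses (wf : gamma_triple_wf G) (rep : gt_represents R G alpha beta).

Let e13_neq1 : e (1 / 3) != 1.
Proof. by apply: e2pi_neq1. Qed.

Let e23_neq1 : e (2 / 3) != 1.
Proof. by apply: e2pi_neq1. Qed.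

Let gam_neq0 j : gam G j != 0.
Proof. by case: wf. Qed.

Lemma card_neg_pos :
  (#|[pred j | (gam G j < 0)%R]| + #|[pred j | (0 < gam G j)%R]| = gt_d G + 2)%N.
Proof.
rewrite addn2 -[RHS](card_ord (gt_d G).+2) -(cardC [pred j | gam G j < 0]).
by congr addn; apply: eq_card => j; rewrite !inE -leNgt lt_def gam_neq0.
Qed.

(** Compare orders of vanishing at 1, where every factor T^n - 1 vanishes. *)
Lemma card_pos_neg :
  #|[pred j | (0 < gam G j)%R]| = (#|[pred j | (gam G j < 0)%R]| + 2)%N.
Proof.
have := gt_represents_mup rep 1; rewrite (negPf e13_neq1) (negPf e23_neq1) eqxx.
rewrite !add0n muln1 mup_gt_num mup_gt_den.
under eq_bigr do rewrite expr1n eqxx; rewrite sum1_card => ->.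
by under eq_bigr do rewrite expr1n eqxx; rewrite sum1_card.
Qed.

(** The left-hand side has a zero at a primitive cube root of unity, so some
    factor of the numerator has one too. *)
Lemma neg_multiple_of_three : exists2 j, gam G j < 0 & (e (1 / 3)) ^+ `|gam G j| = 1.
Proof.
have := gt_represents_mup rep (e (1 / 3)); rewrite eqxx (negPf e13_neq1) muln0 addn0.
rewrite mup_gt_num => sum_pos.
have [j gj ej] : exists2 j, gam G j < 0 & (e (1 / 3) ^+ `|gam G j| == 1).
  apply/exists_inP; apply: contraT; rewrite negb_exists_in => /forall_inP none.
  by move: sum_pos; rewrite [RHS]big1 // => j /none /negPf ->.
by exists j => //; apply/eqP.
Qed.

Lemma level1_length : (2 <= gt_d G)%N.
Proof.
have [j gj _] := neg_multiple_of_three.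
have : (0 < #|[pred j | (gam G j < 0)%R]|)%N by apply/card_gt0P; exists j.
by have := card_neg_pos; have := card_pos_neg; lia.
Qed.

(** With at most four entries, exactly one, say -M, is negative, and M >= 3 by
    the zero at a primitive cube root of unity.  If M > 3, the zero of T^M - 1 at
    a primitive M-th root of unity must cancel against a positive entry divisible
    by M; this is impossible, as the three positive entries add up to M. *)
Lemma level1_shortest : (gt_d G <= 2)%N ->
  gt_d G = 2%N /\ exists j0, gam G j0 = -3 /\ forall j, j != j0 -> gam G j = 1.
Proof.
move=> d2; have d2E : gt_d G = 2%N by apply/eqP; rewrite eqn_leq d2 level1_length.
split=> //; have [j0 neg0 e0] := neg_multiple_of_three.
have card_neg1 : #|[pred j | (gam G j < 0)%R]| = 1%N.
  by have := card_neg_pos; have := card_pos_neg; lia.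
have only_neg j : (gam G j < 0) = (j == j0).
  have : [pred j | (gam G j < 0)%R] =i pred1 j0.
    have [i negE] := mem_card1 card_neg1.
    by have := negE j0; rewrite !inE neg0 => /esym/eqP ->.
  by move=> /(_ j); rewrite !inE.
have pos j : j != j0 -> 0 < gam G j.
  by rewrite -only_neg -leNgt lt_def gam_neq0.
have sum0 : \sum_(j | j != j0) gam G j = - gam G j0.
  by case: wf => _ + _ _; rewrite (bigD1 j0) //= => /eqP; rewrite addrC addr_eq0 => /eqP.
set M := `|gam G j0|%N; have gam0 : gam G j0 = - M%:Z by rewrite /M ltz0_abs ?opprK.
have card_other : #|[pred j | j != j0]| = 3%N.
  by rewrite (eq_card (B := predC1 j0)) // cardC1 card_ord d2E.
(* The positive entries are at least 1, and the sum of their excesses over 1 is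
   M - 3. *)
have excess_ge0 j : j != j0 -> 0 <= gam G j - 1 by move=> /pos; lia.
have excess : \sum_(j | j != j0) (gam G j - 1) = M%:Z - 3.
  by rewrite sumrB sum0 gam0 opprK sumr_const card_other.
have M3 : (3 <= M)%N.
  rewrite leqNgt; apply/negP => M_lt3; have M_gt0 : (0 < M < 3)%N.
    by rewrite M_lt3 absz_gt0 gam_neq0.
  by have := e2piV_exp_neq1 R M_gt0; rewrite -div1r e0 eqxx.
have M_le3 : (M <= 3)%N.
  rewrite leqNgt; apply/negP => M_gt3; have M_gt0 : (0 < M)%N by apply: leq_trans M3.
  set z := e M%:R^-1.
  have z3 : z ^+ 3 != 1 by apply: e2piV_exp_neq1; rewrite M_gt3.
  have z1 : z != 1 by apply: contra_neq z3 => ->; rewrite expr1n.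
  have z13 : e (1 / 3) != z.
    by apply: contra_neq z3 => <-; rewrite -e2piMn -e2pi1; congr e.
  have z23 : e (2 / 3) != z.
    apply: contra_neq z3 => <-; rewrite -e2piMn.
    by have -> : (2 / 3 : rat) *+ 3 = 1 + 1 by []; rewrite e2piD e2pi1 mulr1.
  have := gt_represents_mup rep z.
  rewrite (negPf z13) (negPf z23) (negPf z1) muln0 addn0 !add0n mup_gt_num.
  rewrite (bigD1 j0) //= e2piV_exp // eqxx mup_gt_den => sum_pos.
  have [j gj zj] : exists2 j, 0 < gam G j & (z ^+ `|gam G j| == 1).
    apply/exists_inP; apply: contraT; rewrite negb_exists_in => /forall_inP none.
    by move: sum_pos; rewrite [LHS]big1 // => j /none /negPf ->.
  have jj0 : j != j0 by rewrite -only_neg -leNgt ltW.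
  have : gam G j - 1 <= M%:Z - 3.
    rewrite -excess (bigD1 j) //= lerDl sumr_ge0 // => i /andP [ij0 _].
    exact: excess_ge0.
  move=> gjM; have gj_ltM : (0 < `|gam G j| < M)%N by lia.
  by have := e2piV_exp_neq1 R gj_ltM; rewrite -/z (eqP zj) eqxx.
have M3E : M = 3%N by apply/eqP; rewrite eqn_leq M_le3 M3.
exists j0; split=> [|j jj0]; first by rewrite gam0 M3E.
have := psumr_eq0P excess_ge0; rewrite excess M3E subrr => /(_ erefl j jj0) /eqP.
by rewrite subr_eq0 => /eqP.
Qed.

End LevelOne.
End CubicTriple.

(** * Orthogonality of characters and Gauss sums *)

Section Characters.
Variables (R : realType) (F : finFieldType) (psi chi : F -> R[i]).
Hypotheses (hpsi : nontrivial_add_char psi) (hchi : mult_char chi).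
Hypothesis ordchi : mult_char_order chi #|F|.-1.
Local Notation C := R[i].
Local Notation q := #|F|.
Local Notation g := (gauss psi chi).

Lemma card_pred_gt0 : (0 < q.-1)%N.
Proof. by case: ordchi. Qed.

Lemma card_predK : q.-1.+1 = q.
Proof. by rewrite prednK // (leq_trans card_pred_gt0 (leq_pred _)). Qed.

Lemma natr_card_pred : q.-1%:R = q%:R - 1 :> C.
Proof. by rewrite -[in RHS]card_predK -natr1 addrK. Qed.

Lemma card_neq0 : q%:R != 0 :> C.
Proof. by rewrite pnatr_eq0 -card_predK. Qed.

Lemma card_pred_neq0 : q%:R - 1 != 0 :> C.
Proof. by rewrite -natr_card_pred pnatr_eq0 -lt0n card_pred_gt0. Qed.

#[local] Hint Resolve card_pred_gt0 card_neq0 card_pred_neq0 : core.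

Let N10 : (-1 : F) != 0.
Proof. by rewrite oppr_eq0 oner_eq0. Qed.

Lemma dvdn_residue (m : 'I_(q.-1)) :
  (q.-1 %| m)%N = (m == Ordinal card_pred_gt0).
Proof.
by rewrite -val_eqE /=; case: (posnP m) => [->|m0]; rewrite ?dvdn0 // gtnNdvd.
Qed.

Lemma card_nonzero : #|[pred x : F | x != 0]| = q.-1.
Proof. by rewrite -(cardC (pred1 (0 : F))) card1 /=; apply: eq_card. Qed.

Lemma chi1 : chi 1 = 1.
Proof. by case: hchi. Qed.

Lemma chiM x y : x != 0 -> y != 0 -> chi (x * y) = chi x * chi y.
Proof. by case: hchi => _; apply. Qed.

Lemma chi_neq0 x : x != 0 -> chi x != 0.
Proof.
move=> x0; apply/eqP => c0; have: chi (x * x^-1) = 0.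
  by rewrite chiM ?invr_eq0 // c0 mul0r.
by rewrite divff // chi1 => /eqP; rewrite oner_eq0.
Qed.

Lemma chiX x n : x != 0 -> chi (x ^+ n) = chi x ^+ n.
Proof.
move=> x0; elim: n => [|n IH]; first exact: chi1.
by rewrite !exprS chiM ?expf_neq0 // IH.
Qed.

Lemma chiV x : x != 0 -> chi x^-1 = (chi x)^-1.
Proof.
move=> x0; apply: (mulIf (chi_neq0 x0)).
by rewrite -chiM ?invr_eq0 // mulVf // mulVf ?chi1 // chi_neq0.
Qed.

Lemma chi_order_unity x : x != 0 -> chi x ^+ q.-1 = 1.
Proof. by move=> x0; case: ordchi => _ /(_ q.-1) [_ h]; apply: h. Qed.

Lemma chiz_periodic x (m n : int) :
  x != 0 -> (q.-1%:Z %| m - n)%Z -> chi x ^ m = chi x ^ n.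
Proof.
move=> x0 /dvdzP [a ha]; have -> : m = q.-1%:Z * a + n by rewrite mulrC -ha subrK.
rewrite expfzDr ?chi_neq0 // -exprz_exp.
by rewrite -exprnP chi_order_unity // exp1rz mul1r.
Qed.

(** The nonzero elements are the (q-1)-th roots of unity in F, and a field that
    has n of them contains a primitive one. *)
Lemma generator_exists :
  exists2 w : F, w != 0 & forall x, x != 0 -> exists i, x = w ^+ i.
Proof.
have rootsP : all (q.-1).-unity_root (enum [pred x : F | x != 0]).
  apply/allP => x; rewrite mem_enum inE unity_rootE => x0.
  apply/eqP/(mulIf x0).
  by rewrite -exprSr card_predK expf_card mul1r.
have /hasP [w] := has_prim_root card_pred_gt0 rootsP (enum_uniq _)
  (eq_leq (etrans (esym card_nonzero) (cardE _))).
rewrite mem_enum inE => w0 prw; exists w => // x x0.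
have : x ^+ q.-1 = 1.
  by apply: (mulIf x0); rewrite -exprSr card_predK expf_card mul1r.
by case/(prim_rootP prw) => i ->; exists i.
Qed.

Lemma chi_generator : exists2 w : F, w != 0 &
  forall m : int, chi w ^ m = 1 <-> (q.-1%:Z %| m)%Z.
Proof.
have [w w0 wP] := generator_exists; exists w => // m; split; last first.
  by move=> qm; rewrite (@chiz_periodic w m 0) // subr0.
move=> cm; rewrite dvdzE /=; case: ordchi => _ /(_ `|m|%N) [h _]; apply: h => x.
case/wP => i ->; rewrite chiX // -exprM mulnC exprM.
suff -> : chi w ^+ `|m|%N = 1 by rewrite expr1n.
by case: m cm => n //= cm; apply: invr_inj; rewrite invr1.
Qed.

Lemma chi_eq1 x : x != 0 -> (chi x == 1) = (x == 1).
Proof.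
move=> x0; apply/eqP/eqP => [cx|->]; last exact: chi1.
have [w w0 wP] := generator_exists; have [i def_x] := wP x x0.
suff /dvdnP [j def_i] : (q.-1 %| i)%N.
  have wq : w ^+ q.-1 = 1.
    by apply: (mulIf w0); rewrite -exprSr card_predK expf_card mul1r.
  by rewrite def_x def_i mulnC exprM wq expr1n.
case: ordchi => _ /(_ i) [h _]; apply: h => y /wP [j ->].
by rewrite chiX // -exprM mulnC exprM -chiX // -def_x cx expr1n.
Qed.

Lemma sum_chi_nonzero (m : int) :
  \sum_(x : F | x != 0) chi x ^ m = if (q.-1%:Z %| m)%Z then q%:R - 1 else 0.
Proof.
case: ifPn => [qm|nqm].
  rewrite (eq_bigr (fun=> 1)) => [|x x0]; last first.
    by rewrite (@chiz_periodic x m 0) // subr0.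
  by rewrite sumr_const card_nonzero natr_card_pred.
have [w w0 wP] := chi_generator; have cw1 : chi w ^ m != 1.
  by apply: contra nqm => /eqP/wP.
set S := \sum_(_ | _) _; have : chi w ^ m * S = S.
  rewrite mulr_sumr [RHS](reindex_inj (mulfI w0)) /=.
  apply: eq_big => [x|x x0]; first by rewrite mulf_eq0 negb_or w0.
  by rewrite chiM // expfzMl.
move/eqP; rewrite -subr_eq0 -{2}[S]mul1r -mulrBl mulf_eq0 subr_eq0.
by rewrite (negPf cw1) => /eqP.
Qed.

Lemma sum_chi_exponents x :
  x != 0 -> \sum_(m < q.-1) chi x ^ m%:Z = if x == 1 then q%:R - 1 else 0.
Proof.
move=> x0; case: eqVneq => [->|x1].
  rewrite (eq_bigr (fun=> 1)) => [|m _]; last by rewrite chi1 exp1rz.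
  by rewrite sumr_const card_ord natr_card_pred.
have := subrX1 (chi x) q.-1; rewrite chi_order_unity // subrr => /esym/eqP.
by rewrite mulf_eq0 subr_eq0 chi_eq1 // (negPf x1) => /eqP.
Qed.

Lemma psi0 : psi 0 = 1.
Proof. by case: hpsi. Qed.

Lemma psiD x y : psi (x + y) = psi x * psi y.
Proof. by case: hpsi => _ ->. Qed.

Lemma sum_psi a : \sum_x psi (a * x) = if a == 0 then q%:R else 0.
Proof.
case: eqVneq => [->|a0].
  rewrite (eq_bigr (fun=> 1)) => [|x _]; last by rewrite mul0r psi0.
  by rewrite sumr_const.
transitivity (\sum_x psi x); first by rewrite [RHS](reindex_inj (mulfI a0)).
case: hpsi => _ _ [w pw]; set S := \sum_(_ | _) _.
have : psi w * S = S.
  rewrite mulr_sumr [RHS](reindex_inj (addrI w)) /=.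
  by apply: eq_bigr => x _; rewrite psiD.
move/eqP; rewrite -subr_eq0 -{2}[S]mul1r -mulrBl mulf_eq0 subr_eq0.
by rewrite (negPf pw) => /eqP.
Qed.

Lemma sum_psi_nonzero a :
  \sum_(x | x != 0) psi (x * a) = (if a == 0 then q%:R else 0) - 1.
Proof.
rewrite -sum_psi [in RHS](bigD1 0) //= mulr0 psi0 addrC addrK.
by apply: eq_bigr => x _; rewrite mulrC.
Qed.

Lemma gauss_periodic (m n : int) : (q.-1%:Z %| m - n)%Z -> g m = g n.
Proof.
by move=> mn; apply: eq_bigr => x x0; rewrite (chiz_periodic x0 mn).
Qed.

Lemma gauss_trivial (m : int) : (q.-1%:Z %| m)%Z -> g m = -1.
Proof.
move=> qm; rewrite (@gauss_periodic m 0) ?subr0 // /gauss.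
have := sum_psi_nonzero 1; rewrite oner_eq0 sub0r => <-.
by apply: eq_bigr => x _; rewrite expr0z !mulr1.
Qed.

Lemma gauss_scaled (a : F) (m : int) : a != 0 ->
  \sum_(x | x != 0) chi x ^ m * psi (a * x) = chi a ^ (- m) * g m.
Proof.
move=> a0; rewrite /gauss mulr_sumr [RHS](reindex_inj (mulfI a0)) /=.
apply: eq_big => [x|x x0]; first by rewrite mulf_eq0 negb_or a0.
have cancel_a : chi a ^ (- m) * chi a ^ m = 1.
  by rewrite -expfzDr ?chi_neq0 // addNr expr0z.
rewrite chiM // expfzMl -[LHS]mul1r -cancel_a; ring.
Qed.

(** Substitute y = x z in the double sum over x and y, and sum over x first: the
    inner sum of psi(x (1 + z)) is -1 except at z = -1. *)
Lemma gaussMN (m : int) : g m * g (- m) =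
  q%:R * chi (-1) ^ m - (if (q.-1%:Z %| m)%Z then q%:R - 1 else 0).
Proof.
transitivity (\sum_(x | x != 0) \sum_(z | z != 0) chi z ^ (- m) * psi (x * (1 + z))).
  rewrite /gauss mulr_suml; apply: eq_bigr => x x0.
  rewrite mulr_sumr (reindex_inj (mulfI x0)) /=.
  apply: eq_big => [z|z z0]; first by rewrite mulf_eq0 negb_or x0.
  have cancel_x : chi x ^ m * chi x ^ (- m) = 1.
    by rewrite -expfzDr ?chi_neq0 // subrr expr0z.
  move: z0; rewrite mulf_eq0 negb_or => /andP [_ z0].
  rewrite chiM // expfzMl mulrDr mulr1 psiD -[RHS]mul1r -cancel_x; ring.
rewrite exchange_big /=; under eq_bigr => z z0 do
  rewrite -mulr_sumr sum_psi_nonzero mulrBr mulr1.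
rewrite sumrB sum_chi_nonzero !dvdzE abszN; congr (_ - _).
rewrite (bigD1 (-1)) //= addrN eqxx big1 ?addr0 => [|z /andP [_ zN1]]; last first.
  by rewrite addrC addr_eq0 (negPf zN1) mulr0.
by rewrite mulrC -(@exprz_inv _ (chi (-1)) m) -chiV // invrN invr1.
Qed.

Lemma chiN1_sqr : chi (-1) ^+ 2 = 1.
Proof. by rewrite -chiX ?oppr_eq0 ?oner_eq0 // sqrrN expr1n chi1. Qed.

Lemma chiN1_even (m n : int) : chi (-1) ^ (m + 2 * n) = chi (-1) ^ m.
Proof.
rewrite expfzDr ?chi_neq0 ?oppr_eq0 ?oner_neq0 // -[X in _ * X]exprz_exp.
by rewrite -[chi (-1) ^ 2]/(chi (-1) ^+ 2) chiN1_sqr exp1rz mulr1.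
Qed.

(** * Twisted point counts on the curve 27 x y = t (1 + x + y)^3 *)

Definition curve_sum (e : int) (t : F) : C :=
  \sum_(x | x != 0)
    \sum_(y | (y != 0) && (27 * x * y == t * (1 + x + y) ^+ 3)) chi x ^ e.

(** The auxiliary variable w stands for 1 + x + y: the sum over a detects this
    equality, and the sum over m detects 27 x y = t w^3. *)
Lemma curve_detect (t x y : F) : 27 != 0 :> F -> t != 0 -> x != 0 -> y != 0 ->
  \sum_(w | w != 0) (\sum_a psi (a * (1 + x + y - w))) *
     (\sum_(m < q.-1) chi (t * w ^+ 3 / (27 * x * y)) ^ m%:Z)
  = if 27 * x * y == t * (1 + x + y) ^+ 3 then q%:R * (q%:R - 1) else 0.
Proof.
move=> n27 t0 x0 y0.
have xy0 : 27 * x * y != 0 by rewrite !mulf_neq0.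
have psi_sum w : \sum_a psi (a * (1 + x + y - w)) = if w == 1 + x + y then q%:R else 0.
  under eq_bigr do rewrite mulrC.
  by rewrite sum_psi subr_eq0 eq_sym.
under eq_bigr => w w0.
  rewrite psi_sum sum_chi_exponents; last by rewrite !mulf_neq0 ?expf_neq0 ?invr_neq0.
  over.
have [s0|s0] := eqVneq (1 + x + y) 0.
  rewrite s0 expr0n mulr0 (negPf xy0) big1 // => w w0.
  by rewrite (negPf w0) mul0r.
rewrite (bigD1 (1 + x + y)) //= eqxx big1 ?addr0; last first.
  by move=> w /andP [_ /negPf ->]; rewrite mul0r.
rewrite -(inj_eq (mulIf xy0)) mul1r divfK // eq_sym.
by case: ifP => _; rewrite ?mulr0.
Qed.

Lemma sum_prod3 (A B D : F -> C) (P : pred F) :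
  \sum_(x | P x) \sum_(y | P y) \sum_(w | P w) A x * B y * D w =
  (\sum_(x | P x) A x) * (\sum_(y | P y) B y) * (\sum_(w | P w) D w).
Proof.
rewrite 2!mulr_suml; apply: eq_bigr => x _.
rewrite -mulrA mulr_suml mulr_sumr; apply: eq_bigr => y _.
by rewrite !mulr_sumr; apply: eq_bigr => w _; rewrite mulrA.
Qed.

(** With both equations detected by characters, the sums over x, y and w separate.
    The terms with a != 0 are products of Gauss sums, and the summation over a
    supplies the fourth one, the total exponent of chi(a) being -m - e.
    The terms with a = 0 survive only when all three characters are trivial,
    that is, for m = 0 and trivial chi^e. *)
Lemma curve_sum_gauss (e : int) (t : F) : 27 != 0 :> F -> t != 0 ->
  q%:R * (q%:R - 1) * curve_sum e t =
  \sum_(m < q.-1) chi (- t / 27) ^ m%:Z *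
     (g (e - m%:Z) * g (- m%:Z) * g (- m%:Z - e) * g (3 * m%:Z))
  + (if (q.-1%:Z %| e)%Z then (q%:R - 1) ^+ 3 else 0).
Proof.
move=> n27 t0; pose G n a := \sum_(x | x != 0) chi x ^ n * psi (a * x).
transitivity (\sum_(m < q.-1) chi (t / 27) ^ m%:Z *
   \sum_a psi a * (G (e - m%:Z) a * G (- m%:Z) a * G (3 * m%:Z) (- a))).
  transitivity (\sum_(x | x != 0) \sum_(y | y != 0) \sum_(w | w != 0)
      \sum_(m < q.-1) \sum_a chi (t / 27) ^ m%:Z * (psi a *
       ((chi x ^ (e - m%:Z) * psi (a * x)) * (chi y ^ (- m%:Z) * psi (a * y))
         * (chi w ^ (3 * m%:Z) * psi (- a * w))))).
    rewrite /curve_sum mulr_sumr; apply: eq_bigr => x x0.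
    rewrite big_mkcondr mulr_sumr; apply: eq_bigr => y y0.
    transitivity (chi x ^ e * (if 27 * x * y == t * (1 + x + y) ^+ 3
                      then q%:R * (q%:R - 1) else 0)).
      by case: ifP => _; rewrite ?mulr0 // mulrC.
    rewrite -curve_detect // mulr_sumr; apply: eq_bigr => w w0.
    rewrite mulrCA mulr_sumr exchange_big /= mulr_suml.
    apply: eq_bigr => a _; rewrite mulr_sumr; apply: eq_bigr => m _.
    have -> : t * w ^+ 3 / (27 * x * y) = (t / 27) * w ^+ 3 * x^-1 * y^-1.
      by field; rewrite y0 x0 n27.
    rewrite (_ : a * _ = a + a * x + a * y + - a * w); last by ring.
    have W0 : w ^+ 3 != 0 by rewrite expf_neq0.
    have cw : chi (w ^+ 3) ^ m%:Z = chi w ^ (3 * m%:Z).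
      by rewrite chiX // -[RHS]exprz_exp.
    move: (w ^+ 3) W0 cw => W W0 cw.
    rewrite !psiD !chiM ?chiV ?mulf_neq0 ?invr_neq0 //.
    rewrite !expfzMl cw !exprz_inv expfzDr ?chi_neq0 //.
    ring.
  under eq_bigr => x _.
    under eq_bigr => y _ do rewrite exchange_big /=.
    rewrite exchange_big /=; over.
  rewrite exchange_big /=; apply: eq_bigr => m _.
  under eq_bigr => x _.
    under eq_bigr => y _ do rewrite exchange_big /=.
    rewrite exchange_big /=; over.
  rewrite exchange_big /= mulr_sumr; apply: eq_bigr => a _.
  rewrite -sum_prod3 !mulr_sumr; apply: eq_bigr => x _.
  rewrite !mulr_sumr; apply: eq_bigr => y _.
  by rewrite !mulr_sumr.
have G0 n : G n 0 = if (q.-1%:Z %| n)%Z then q%:R - 1 else 0.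
  rewrite -sum_chi_nonzero; apply: eq_bigr => x _.
  by rewrite mul0r psi0 mulr1.
have chiN1_exp (m : int) : chi (-1) ^ (- (3 * m)) = chi (-1) ^ m.
  by rewrite (_ : - (3 * m) = m + 2 * (- (2 * m))) ?chiN1_even //; ring.
transitivity (\sum_(m < q.-1) (chi (- t / 27) ^ m%:Z *
     (g (e - m%:Z) * g (- m%:Z) * g (- m%:Z - e) * g (3 * m%:Z))
   + chi (t / 27) ^ m%:Z * (G (e - m%:Z) 0 * G (- m%:Z) 0 * G (3 * m%:Z) 0))).
  apply: eq_bigr => m _; rewrite (bigD1 0) //= psi0 mul1r oppr0 mulrDr addrC.
  congr (_ + _).
  have -> : chi (- t / 27) ^ m%:Z = chi (t / 27) ^ m%:Z * chi (-1) ^ m%:Z.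
    by rewrite -expfzMl -chiM ?mulf_neq0 ?invr_neq0 // mulrN1 mulNr.
  rewrite -[RHS]mulrA.
  congr (_ * _); rewrite -chiN1_exp.
  transitivity (chi (-1) ^ (- (3 * m%:Z)) * (g (e - m%:Z) * g (- m%:Z) * g (3 * m%:Z))
                * g (- m%:Z - e)); last by ring.
  rewrite [g (- m%:Z - e)]/gauss mulr_sumr; apply: eq_bigr => a a0.
  rewrite /G !gauss_scaled ?oppr_eq0 // -[- a]mulN1r chiM // expfzMl.
  have -> : chi a ^ (- m%:Z - e) =
      chi a ^ (- (e - m%:Z)) * chi a ^ (- - m%:Z) * chi a ^ (- (3 * m%:Z)).
    by rewrite -!expfzDr ?chi_neq0 //; congr (_ ^ _); ring.
  ring.
rewrite big_split /=; congr (_ + _).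
rewrite (bigD1 (Ordinal card_pred_gt0)) //= big1 ?addr0 => [|m m0].
  rewrite expr0z mul1r mulr0 oppr0 !G0 !dvdz0.
  by case: ifP => _; rewrite ?mul0r // !exprS expr0 mulr1 mulrA.
rewrite [G (- _) 0]G0 ifN ?mulr0 ?mul0r ?mulr0 //.
by rewrite dvdzE abszN /= dvdn_residue.
Qed.

(** Detect a^3 = x by multiplicative characters; summing over a leaves the
    characters whose cube is trivial. *)
Lemma cube_root_count (x : F) : x != 0 ->
  #|[pred a : F | a ^+ 3 == x]|%:R =
  \sum_(m < q.-1 | (q.-1 %| 3 * m)%N) chi x ^ (- m%:Z) :> C.
Proof.
move=> x0; apply: (mulfI card_pred_neq0).
transitivity (\sum_(a | a != 0) \sum_(m < q.-1) chi (a ^+ 3 / x) ^ m%:Z).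
  have -> : #|[pred a : F | a ^+ 3 == x]|%:R =
            \sum_(a | a != 0) (if a ^+ 3 == x then 1 else 0) :> C.
    rewrite -sum1_card natr_sum -big_mkcondr; apply: eq_bigl => a.
    rewrite -topredE /=; case: (eqVneq a 0) => [->|] //=.
    by rewrite expr0n eq_sym (negPf x0).
  rewrite mulr_sumr; apply: eq_bigr => a a0.
  rewrite sum_chi_exponents ?mulf_neq0 ?expf_neq0 ?invr_neq0 //.
  have -> : (a ^+ 3 / x == 1) = (a ^+ 3 == x) by rewrite -(inj_eq (mulIf x0)) divfK // mul1r.
  by case: ifP => _; rewrite ?mulr1 ?mulr0.
rewrite exchange_big /= mulr_sumr [RHS]big_mkcond; apply: eq_bigr => m _.
transitivity (chi x ^ (- m%:Z) * \sum_(a | a != 0) chi a ^ (3 * m%:Z)).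
  rewrite mulr_sumr; apply: eq_bigr => a a0.
  rewrite chiM ?expf_neq0 ?invr_neq0 // chiX // chiV // mulrC.
  by rewrite [LHS]expfzMl exprz_inv -[X in _ = _ * X]exprz_exp.
rewrite sum_chi_nonzero dvdzE /=.
by case: ifP => _; rewrite ?mulr0 // mulrC.
Qed.

Lemma sum_multiples_third (k : nat) (f : nat -> C) : (0 < k)%N ->
  \sum_(m < 3 * k | (3 * k %| 3 * m)%N) f m = f 0%N + f k + f (2 * k)%N.
Proof.
move=> k0; have lt3 (i : 'I_3) : (i * k < 3 * k)%N by rewrite ltn_pmul2r.
rewrite (reindex_onto (fun i : 'I_3 => Ordinal (lt3 i)) (fun m => inord (m %/ k))) /=.
  rewrite (eq_bigl predT) => [|i]; last first.
    rewrite -val_eqE /= inordK ?mulnK ?eqxx ?andbT //.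
    by rewrite dvdn_pmul2l // dvdn_mull.
  by rewrite !big_ord_recl big_ord0 /= addr0 addrA mul0n mul1n.
move=> m; rewrite dvdn_pmul2l // => km; apply: val_inj => /=.
by rewrite inordK ?divnK // ltn_divLR // mulnC.
Qed.

Lemma mulrn_card (x : F) : x *+ q = 0.
Proof. by have := expg_cardG (finset.in_setT x); rewrite FinRing.zmodXgE cardsT. Qed.

Lemma three_neq0_card : (q %% 3 != 0)%N -> 3 != 0 :> F.
Proof.
move=> q3; apply: contra_neq (oner_neq0 F) => three0.
have := mulrn_card 1; rewrite {1}(divn_eq q 3) natrD natrM three0 mulr0 add0r.
have : (q %% 3 < 3)%N by rewrite ltn_mod.
case: (q %% 3)%N q3 => [|[|[|]]] // _ _ two0.
have -> : 1 = 3 - 2 :> F by ring.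
by rewrite three0 two0 subr0.
Qed.

Lemma normC_root_unity (z : C) n : (0 < n)%N -> z ^+ n = 1 -> `|z| = 1.
Proof.
move=> n0 zn; apply/eqP; rewrite -(@pexpr_eq1 _ _ n) // ?normr_ge0 //.
by rewrite -normrX zn normr1.
Qed.

Lemma conjC_unit (z : C) : `|z| = 1 -> (z^*)%R = z^-1.
Proof. by move=> z1; rewrite invC_norm z1 expr1n invr1 mul1r. Qed.

(** The values of psi and chi are roots of unity, so that conjugating inverts. *)
Lemma conj_psi x : ((psi x)^*)%R = psi (- x).
Proof.
have psiX n : psi (x *+ n) = psi x ^+ n.
  elim: n => [|n IH]; first by rewrite mulr0n psi0.
  by rewrite mulrS psiD IH exprS.
rewrite conjC_unit; last first.
  apply: (@normC_root_unity _ q); last by rewrite -psiX mulrn_card psi0.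
  exact: leq_trans card_pred_gt0 (leq_pred _).
have psi_unit : psi x * psi (- x) = 1 by rewrite -psiD subrr psi0.
have px0 : psi x != 0.
  by apply: contraTneq (oner_neq0 C) => p0; rewrite -psi_unit p0 mul0r eqxx.
by apply: (mulfI px0); rewrite divff.
Qed.

Lemma conj_chi x (m : int) : x != 0 -> ((chi x ^ m)^*)%R = chi x ^ (- m).
Proof.
move=> x0; have conj_chi1 : ((chi x)^*)%R = (chi x)^-1.
  by rewrite conjC_unit // (normC_root_unity card_pred_gt0) ?chi_order_unity.
rewrite -exprz_inv -conj_chi1.
by case: m => n; rewrite ?NegzE -?exprnP -?exprnN ?fmorphV rmorphXn.
Qed.

Lemma conj_gauss (m : int) : ((g m)^*)%R = chi (-1) ^ m * g (- m).
Proof.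
rewrite /gauss rmorph_sum mulr_sumr [RHS](reindex_inj oppr_inj) /=.
apply: eq_big => [x|x x0]; first by rewrite oppr_eq0.
rewrite rmorphM /= conj_chi // conj_psi -[in RHS](mulN1r x) chiM // expfzMl.
have : chi (-1) ^ m * chi (-1) ^ (- m) = 1 by rewrite -expfzDr ?chi_neq0 // subrr.
by move=> e; rewrite mulrCA [in RHS](mulrA (chi (-1) ^ m)) e mul1r mulN1r.
Qed.

Lemma gauss_norm (m : int) :
  g m * ((g m)^*)%R = if (q.-1%:Z %| m)%Z then 1 else q%:R.
Proof.
case: ifP => qm; first by rewrite gauss_trivial // rmorphN rmorph1 mulrNN mulr1.
rewrite conj_gauss mulrCA gaussMN qm subr0 mulrCA -expfzMl.
by rewrite -[chi (-1) * _]/(chi (-1) ^+ 2) chiN1_sqr exp1rz mulr1.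
Qed.

Lemma sqr_norm_sub (x y : C) : x * (x^*)%R = y * (y^*)%R ->
  `|x - y| ^+ 2 = y * (y^*)%R *+ 2 - x * (y^*)%R - ((x * (y^*)%R)^*)%R.
Proof.
move=> xy; rewrite normCK rmorphB rmorphM /= conjCK mulr2n -{1}xy; ring.
Qed.

(** * The hypergeometric sum of the gamma triple (-3, 1, 1, 1) *)

Local Notation e := (e2pi R).
Local Notation alpha := [tuple 1 / 3; 2 / 3 : rat].
Local Notation beta := [tuple 1; 1 : rat].
Local Notation gam G j := (tnth (gt_gamma G) j).

Lemma e2pi_residue_eq1 (m : 'I_(q.-1)) :
  (e ((- m%:Z)%:~R / q.-1%:R) == 1) = (m == Ordinal card_pred_gt0).
Proof.
rewrite -val_eqE /=; case: posnP => [->|m0]; first by rewrite oppr0 mul0r e2pi0 eqxx.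
apply/negbTE; rewrite rmorphN mulNr; apply: e2piN_neq1.
rewrite divr_gt0 ?ltr0n ?ltr0z //= ltr_pdivrMr ?ltr0n // mul1r.
by rewrite -[_%:~R]/(m%:R) ltr_nat ltn_ord.
Qed.

Section GammaThreeOneOneOne.
Variables (G : gamma_triple) (j0 : 'I_(gt_d G).+2).
Hypotheses (N1 : gt_N G = 1%N) (d2 : gt_d G = 2%N).
Hypotheses (gam0 : gam G j0 = -3) (gam1 : forall j, j != j0 -> gam G j = 1).

Let card_other : #|[pred j | j != j0]| = 3%N.
Proof. by rewrite (eq_card (B := predC1 j0)) // cardC1 card_ord d2. Qed.

Let prod_gam (T : comNzRingType) (f : 'I_(gt_d G).+2 -> T) (x : T) :
  (forall j, j != j0 -> f j = x) -> \prod_j f j = f j0 * x ^+ 3.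
Proof.
by move=> fx; rewrite (bigD1 j0) //= (eq_bigr _ fx) prodr_const card_other.
Qed.

Let sign_gam j : ((gam G j < 0) = (j == j0)) * ((0 < gam G j) = (j != j0)).
Proof. by case: eqVneq => [->|/gam1 ->]; rewrite ?gam0. Qed.

Lemma gt_num_three : gt_num R G = 'X^3 - 1.
Proof.
rewrite gt_num_level1 // (eq_bigl (pred1 j0)) => [|j]; last by rewrite sign_gam.
by rewrite big_pred1_eq gam0.
Qed.

Lemma gt_den_three : gt_den R G = ('X - 1) ^+ 3.
Proof.
rewrite gt_den_level1 // (eq_bigl [pred j | j != j0]) => [|j]; last by rewrite sign_gam.
rewrite (eq_bigr (fun=> 'X - 1)) => [|j /gam1 ->]; last by rewrite expr1.
by rewrite prodr_const card_other.
Qed.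

Lemma gt_mult_three (m : int) : gt_mult R G q m = (e (m%:~R / q.-1%:R) == 1).
Proof.
by rewrite /gt_mult gt_num_three gt_den_three mup_gcd_cubic.
Qed.

(** The exponent of q in the definition by gamma triples is 0 at m = 0 and -1
    elsewhere, because the gcd of T^3 - 1 and (T - 1)^3 is T - 1. *)
Definition cubic_gamma_sum (t : F) : C := (1 - q%:R)^-1 *
  \sum_(m < q.-1) g (3 * m%:Z) * g (- m%:Z) ^+ 3 *
     (if m == Ordinal card_pred_gt0 then 1 else q%:R^-1) * chi (- t / 27) ^ m%:Z.

(** The entries of delta only shift the Gauss sums by multiples of q - 1. *)
Lemma hyp_sum_gamma_three (t : F) : hyp_sum_gamma psi chi G t = cubic_gamma_sum t.
Proof.
rewrite /hyp_sum_gamma /cubic_gamma_sum; congr (_ * _).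
apply: eq_bigr => m _; rewrite N1 divn1.
have -> : \prod_j ((gam G j)%:~R ^ gam G j : F) = - 27^-1.
  rewrite (prod_gam (x := 1)) => [|j /gam1 ->]; last by rewrite expr1z.
  rewrite gam0 expr1n mulr1.
  have -> : 27 = 3 ^+ 3 :> F by ring.
  by rewrite -exprz_inv -[_ ^ 3]/(_ ^+ 3) rmorphN /= invrN -exprVn; ring.
have trivial_shift j : (q.-1%:Z %| tnth (gt_delta G) j * q.-1)%Z by apply: dvdz_mull.
rewrite (eq_bigr (fun j => g (- gam G j * m%:Z))) => [|j _]; last first.
  by apply: gauss_periodic; rewrite addrAC subrr add0r.
rewrite (prod_gam (x := g (- m%:Z))) => [|j /gam1 ->]; last by rewrite mulN1r.
have -> : \prod_j g (tnth (gt_delta G) j * q.-1) = 1.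
  rewrite (prod_gam (x := -1)) => [|j _]; last exact: gauss_trivial.
  by rewrite gauss_trivial // -signr_odd /= expr1 mulrNN mulr1.
rewrite divr1 gam0 opprK !gt_mult_three e2pi_residue_eq1 mul0r e2pi0 eqxx.
congr (_ * _ * _).
  by case: eqP => _; rewrite ?subrr ?expr0z // sub0r exprN1.
rewrite mulrC mulrN -mulNr //.
Qed.

End GammaThreeOneOneOne.

Definition triple3111 : gamma_triple :=
  @GammaTriple 2 [tuple -3; 1; 1; 1] [tuple 0; 0; 0; 0] 1.

Lemma triple3111_gam j : j != ord0 -> gam triple3111 j = 1.
Proof. by case: j => [[|[|[|[|]]]]]. Qed.

Lemma triple3111_represents : gt_represents R triple3111 alpha beta.
Proof.
rewrite /gt_represents (@gt_num_three triple3111 ord0) // ?(@gt_den_three triple3111 ord0) //;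
  try exact: triple3111_gam.
rewrite !big_cons !big_nil !mulr1 e2pi1.
set w := e (1 / 3); have -> : e (2 / 3) = w ^+ 2.
  by rewrite -e2piMn; congr (e _); apply/eqP.
have w3 : w ^+ 3 = 1 by rewrite -e2piMn -(e2pi1 R); congr (e _); apply/eqP.
apply/eqP; rewrite eqr_div ?tofrac_eq0 ?mulf_neq0 ?expf_neq0 ?polyXsubC_eq0 //.
rewrite -!tofracM tofrac_eq; apply/eqP.
by apply: cyclotomic3_ratio w3 _; apply: e2pi_neq1.
Qed.

Lemma triple3111_wf : gamma_triple_wf triple3111.
Proof.
split=> //; first by case=> [[|[|[|[|]]]]].
  by rewrite !big_ord_recl big_ord0.
by rewrite !big_ord_recl big_ord0.
Qed.

Lemma triple3111_usable : (q %% 3 != 0)%N -> usable_triple R F alpha beta triple3111.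
Proof.
move=> q3; split; [exact: triple3111_wf|exact: triple3111_represents|split=> // j].
have [->|/triple3111_gam ->] := eqVneq j ord0; last by rewrite coprimen1.
by rewrite coprime_sym prime_coprime.
Qed.

Lemma simplest_tripleP (G : gamma_triple) : (q %% 3 != 0)%N ->
  simplest_triple R F alpha beta G ->
  [/\ gt_N G = 1%N, gt_d G = 2%N &
      exists j0, gam G j0 = -3 /\ forall j, j != j0 -> gam G j = 1].
Proof.
move=> q3 [[wf rep _]] /(_ _ (triple3111_usable q3)) /= minimal.
have N1 : gt_N G = 1%N by case: wf => _ _ _ N0; case: minimal => [|[]] //; lia.
have [//|d2 gamP] := level1_shortest N1 wf rep.
  by case: minimal => [|[]] //; rewrite N1.
by split.
Qed.

Lemma triple3111_simplest : (q %% 3 != 0)%N ->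
  simplest_triple R F alpha beta triple3111.
Proof.
move=> q3; split; first exact: triple3111_usable.
move=> G [wf rep _]; case: (ltngtP 1%N (gt_N G)) => [|N0|N1]; first by left.
  by case: wf => _ _ _; rewrite lt0n -ltnS; lia.
right; split=> //; exact: (level1_length (esym N1) wf rep).
Qed.

(** Here (q-1)/3 is not an integer, so the value comes from a simplest triple;
    all of these have the same gamma up to order, hence the same sum. *)
Lemma hyp_sum_two_mod_three (t : F) : (q %% 3 = 2)%N ->
  hyp_sum psi chi alpha beta t = cubic_gamma_sum t.
Proof.
move=> q2; have q3 : (q %% 3 != 0)%N by rewrite q2.
rewrite /hyp_sum ifN.
  apply: xget_unique.
    exists triple3111; first exact: triple3111_simplest.
    by apply: (@hyp_sum_gamma_three _ ord0) => //; apply: triple3111_gam.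
  move=> _ [G /(simplest_tripleP q3) [N1 d2 [j0 [gam0 gam1]]] <-].
  exact: (hyp_sum_gamma_three N1 d2 gam0 gam1).
rewrite /hyp_integral /= negb_and; apply/orP; left; rewrite negb_and; apply/orP; left.
apply/negP => /intrP [z /(congr1 ( *%R^~ 3))].
rewrite mul1r divfK // => qz; have : q.-1%:Z = z * 3.
  by apply: (@intr_inj rat); rewrite rmorphM.
by have := card_predK; lia.
Qed.

(** The hypergeometric sum weights the terms of [curve_sum_gauss] by q^-1 except
    at m = 0, where the product of Gauss sums is 1. *)
Lemma curve_sum_untwisted (t : F) : 27 != 0 :> F -> t != 0 ->
  curve_sum 0 t = q%:R - 2 - cubic_gamma_sum t.
Proof.
move=> n27 t0; have qq0 : q%:R * (q%:R - 1) != 0 :> C by rewrite mulf_neq0.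
have oneq0 : 1 - q%:R != 0 :> C by rewrite -opprB oppr_eq0.
apply: (mulfI qq0); rewrite [LHS]curve_sum_gauss // dvdz0.
pose c (m : 'I_(q.-1)) := g (3 * m%:Z) * g (- m%:Z) ^+ 3 * chi (- t / 27) ^ m%:Z.
have c0 : c (Ordinal card_pred_gt0) = 1.
  by rewrite /c /= mulr0 oppr0 gauss_trivial ?dvdz0 // expr0z; ring.
rewrite (eq_bigr c) => [|m _]; last first.
  by rewrite /c add0r subr0; ring.
rewrite /cubic_gamma_sum.
rewrite [in RHS](eq_bigr (fun m => q%:R^-1 * c m +
    if m == Ordinal card_pred_gt0 then 1 - q%:R^-1 else 0)) => [|m _]; last first.
  case: eqP => [->|_]; last by rewrite /c; ring.
  by transitivity (c (Ordinal card_pred_gt0)); [rewrite /c; ring | rewrite c0; ring].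
rewrite big_split /= -mulr_sumr -big_mkcond big_pred1_eq.
by field; rewrite card_neq0 oneq0.
Qed.

(** Cubing is a bijection, so only the untwisted sum contributes. *)
Lemma card_hesse_points_two_mod_three (u : F) : (q %% 3 = 2)%N -> u != 0 ->
  #|hesse_points u|%:R = q%:R + 1 - cubic_gamma_sum (u ^+ 3) :> C.
Proof.
move=> q2 u0; have t0 : u ^+ 3 != 0 by rewrite expf_neq0.
have three0 : 3 != 0 :> F by apply: three_neq0_card; rewrite q2.
have n27 : 27 != 0 :> F by rewrite (_ : 27 = 3 ^+ 3) ?expf_neq0 //; ring.
have one_root x : x != 0 -> #|[pred a : F | a ^+ 3 == x]| = 1%N.
  move=> x0; apply/eqP; rewrite -(eqr_nat C) cube_root_count //; apply/eqP.
  rewrite (big_pred1 (Ordinal card_pred_gt0)) => [|m]; first by rewrite oppr0 expr0z.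
  rewrite /= Gauss_dvdr ?dvdn_residue //.
  rewrite coprime_sym prime_coprime // /dvdn.
  have : (q.-1.+1 %% 3 = 2)%N by rewrite card_predK.
  by move: (q.-1) => n; lia.
rewrite card_hesse_points natrD natrM hesse_torus_count // one_root ?oppr_eq0 ?oner_neq0 //.
transitivity (curve_sum 0 (u ^+ 3) + 3 * 1); last first.
  by rewrite curve_sum_untwisted //; ring.
congr (_ + _); rewrite natr_sum; apply: eq_bigr => x x0.
by rewrite natr_sum; apply: eq_bigr => y _; rewrite one_root // expr0z.
Qed.

Lemma hyp_sum_empty (t : F) : t != 0 ->
  hyp_sum psi chi [tuple] [tuple] t = if t == 1 then -1 else 0.
Proof.
move=> t0; rewrite /hyp_sum /hyp_sum_integral /=.
under eq_bigr do rewrite big_ord0 mul1r expr0 mul1r exprnP.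
rewrite sum_chi_exponents //; case: ifP => _; last by rewrite mulr0.
by rewrite -[q%:R - 1]opprB mulrN mulVf // -opprB oppr_eq0.
Qed.

(** * The nodal curve and the Hasse-Davenport formula for cubic characters *)

Section OneModThree.
Variable k : nat.
Hypothesis qk : q.-1 = (3 * k)%N.

Lemma third_gt0 : (0 < k)%N.
Proof. by move: card_pred_gt0; rewrite qk muln_gt0. Qed.

#[local] Hint Resolve third_gt0 : core.

Lemma chi_third_cube (x : F) (n : int) : x != 0 -> chi (x ^+ 3) ^ (k%:Z * n) = 1.
Proof.
move=> x0; rewrite -exprz_exp -exprnP chiX // -exprM -qk chi_order_unity //.
exact: exp1rz.
Qed.

Lemma cube_root_count_third (x : F) : x != 0 ->
  #|[pred a : F | a ^+ 3 == x]|%:R = 1 + chi x ^ (- k%:Z) + chi x ^ k%:Z :> C.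
Proof.
move=> x0; rewrite cube_root_count // qk.
rewrite (sum_multiples_third (fun m => chi x ^ (- m%:Z))) ?third_gt0 //.
rewrite expr0z; congr (_ + _); apply: chiz_periodic => //.
by apply/dvdzP; exists (-1); rewrite qk; lia.
Qed.

Lemma cube_root_count_cube (x : F) : x != 0 ->
  #|[pred a : F | a ^+ 3 == x ^+ 3]| = 3%N.
Proof.
move=> x0; apply/eqP; rewrite -(eqr_nat C) cube_root_count_third ?expf_neq0 //.
rewrite -[k%:Z]mulr1 -mulrN !chi_third_cube //.
by apply/eqP; ring.
Qed.

Lemma three_neq0 : 3 != 0 :> F.
Proof. by apply: three_neq0_card; rewrite -card_predK qk; lia. Qed.

#[local] Hint Resolve three_neq0 : core.

Let n27 : 27 != 0 :> F.
Proof. by rewrite (_ : 27 = 3 ^+ 3) ?expf_neq0 ?three_neq0 //; ring. Qed.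

(** These are the cube roots of 1 other than 1. *)
Lemma cyclotomic3_root_count : #|[pred a : F | a ^+ 2 + a + 1 == 0]| = 2%N.
Proof.
have := cube_root_count_cube (oner_neq0 F); rewrite expr1n.
rewrite (cardD1 1) inE expr1n eqxx => -[card2].
apply: etrans card2; apply: eq_card => a; rewrite !inE.
rewrite -[a ^+ 3 == 1]subr_eq0 (_ : a ^+ 3 - 1 = (a - 1) * (a ^+ 2 + a + 1)); last by ring.
rewrite mulf_eq0 subr_eq0; case: (eqVneq a 1) => [->|] //=.
by rewrite (_ : _ + _ = 3) ?(negPf three_neq0) //; ring.
Qed.

(** With s = (1 + x + y)/3 the equation says that s^3 = x y.  If x = a^3 and
    y = -(1 + a)^3, then s = - a - a^2 and x - s = a (1 - s), which gives a.
    The node (1, 1) is the only point where s = 1. *)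
Lemma nodal_parametrization (x y : F) (s := (1 + x + y) / 3) (a := (x - s) / (1 - s)) :
  27 * x * y = (1 + x + y) ^+ 3 -> (x, y) != (1, 1) ->
  [/\ s != 1, a ^+ 2 + a + s = 0, a ^+ 3 = x & - (1 + a) ^+ 3 = y].
Proof.
move=> curve not_node; have three0 := three_neq0.
have sum3 : 1 + x + y = 3 * s by rewrite /s mulrCA divff ?mulr1.
have cube_s : s ^+ 3 = x * y.
  apply: (@mulfI _ (3 ^+ 3)); first by rewrite expf_neq0.
  rewrite -exprMn -sum3 -curve; ring.
have def_y : y = 3 * s - 1 - x by rewrite -sum3; ring.
have s1 : s != 1.
  apply: contra not_node => /eqP s1; rewrite s1 in def_y cube_s.
  have : (x - 1) ^+ 2 = 0.
    by rewrite -[RHS](subrr (x * y)) -{1}cube_s def_y; ring.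
  move/eqP; rewrite expf_eq0 /= subr_eq0 => /eqP x1.
  by rewrite def_y x1 xpair_eqE eqxx /=; apply/eqP; ring.
have sub_s : 1 - s != 0 by rewrite subr_eq0 eq_sym.
have quad : a ^+ 2 + a + s = 0.
  apply: (@mulfI _ ((1 - s) ^+ 2)); first by rewrite expf_neq0.
  have def_a : a * (1 - s) = x - s by rewrite divfK.
  transitivity ((x - s) ^+ 2 + (x - s) * (1 - s) + s * (1 - s) ^+ 2).
    by rewrite -def_a; ring.
  rewrite mulr0 -[RHS](subrr (x * y)) -{1}cube_s def_y; ring.
have a3 : a ^+ 3 = x.
  have def_a : a * (1 - s) = x - s by rewrite divfK.
  have -> : x = a * (1 - s) + s by rewrite def_a subrK.
  apply/eqP; rewrite -subr_eq0.
  by apply/eqP; rewrite -[RHS](mulr0 (a - 1)) -quad; ring.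
split=> //; rewrite def_y -a3; apply/eqP; rewrite -subr_eq0.
by apply/eqP; rewrite -[RHS](mulr0 (- 3)) -quad; ring.
Qed.

(** All first coordinates are cubes, so the sum counts points: the node, and one
    point for each a different from 0, -1 (where a coordinate vanishes) and from
    the two roots of a^2 + a + 1 (which both lead to the node). *)
Lemma curve_sum_nodal : curve_sum k%:Z 1 = q%:R - 3.
Proof.
have three0 := three_neq0.
pose h (a : F) := (a ^+ 3, - (1 + a) ^+ 3).
pose param (p : F * F) := let s := (1 + p.1 + p.2) / 3 in (p.1 - s) / (1 - s).
rewrite /curve_sum pair_big_dep /= (bigD1 (1, 1)) /=; last first.
  by rewrite !oner_neq0 mul1r !mulr1 /=; apply/eqP; ring.
rewrite chi1 exp1rz (reindex_onto h param) /=; last first.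
  move=> [x y] /andP [/andP [_ /andP [_ /eqP curve]] node].
  rewrite mul1r in curve.
  by have [_ _ ha hy] := nodal_parametrization curve node; congr (_, _).
rewrite (eq_bigl [pred a : F | [&& a != 0, a != -1 & a ^+ 2 + a + 1 != 0]]); last first.
  move=> a /=; rewrite oppr_eq0 !expf_eq0 /= (addrC 1 a) addr_eq0.
  case: eqVneq => //= a0; case: eqVneq => //= aN1.
  have -> : 27 * a ^+ 3 * - (a + 1) ^+ 3 == 1 * (1 + a ^+ 3 - (a + 1) ^+ 3) ^+ 3.
    by apply/eqP; ring.
  have param_h : param (h a) = (a * (a ^+ 2 + a + 1)) / (a ^+ 2 + a + 1).
    rewrite /param /h /= (_ : (1 + a ^+ 3 - (1 + a) ^+ 3) / 3 = - (a ^+ 2 + a)).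
      by congr (_ / _); ring.
    by field.
  have a3 : a ^+ 3 = 1 + (a - 1) * (a ^+ 2 + a + 1) by ring.
  rewrite param_h xpair_eqE a3; case: (eqVneq (a ^+ 2 + a + 1) 0) => [c0|c0] /=.
    rewrite c0 mulr0 addr0 eqxx /=.
    have -> : - (1 + a) ^+ 3 = 1 - (a + 2) * (a ^+ 2 + a + 1) by ring.
    by rewrite c0 mulr0 subr0 eqxx.
  rewrite mulfK // eqxx andbT; apply/negP => /andP [].
  rewrite -subr_eq0 addrC addKr mulf_eq0 (negPf c0) orbF subr_eq0 => /eqP ->.
  rewrite -subr_eq0 (_ : _ - 1 = - (3 ^+ 2)); last by ring.
  by rewrite oppr_eq0 expf_eq0 (negPf three0).
transitivity (1 + \sum_(a : F | [&& a != 0, a != -1 & a ^+ 2 + a + 1 != 0]) 1 : C).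
  congr (_ + _); apply: eq_bigr => a /andP [a0 _].
  by rewrite -[k%:Z]mulr1 chi_third_cube.
have count_roots : \sum_(a : F | a ^+ 2 + a + 1 == 0) 1 = 2 :> C.
  rewrite sumr_const (eq_card (B := [pred a : F | a ^+ 2 + a + 1 == 0])) //.
  by rewrite cyclotomic3_root_count.
have -> : q%:R = \sum_(a : F) 1 :> C by rewrite sumr_const.
rewrite [in RHS](bigID (fun a : F => a ^+ 2 + a + 1 == 0)) /= count_roots.
rewrite [in RHS](bigD1 0) /=; last by rewrite expr0n !add0r oner_neq0.
rewrite [in RHS](bigD1 (-1)) /=; last first.
  by rewrite sqrrN expr1n addrN add0r oner_neq0 oppr_eq0 oner_neq0.
rewrite (eq_bigl (fun a : F => (a ^+ 2 + a + 1 != 0) && (a != 0) && (a != -1))).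
  by ring.
by move=> a; rewrite andbA andbC andbA.
Qed.

(** The two sides of the Hasse-Davenport formula for the characters of order 3. *)
Let triple (n : int) := g n * g (n + k%:Z) * g (n + 2 * k%:Z).

Let tripled (n : int) := q%:R * chi 27 ^ (- n) * g (3 * n).

Lemma dvd3k (n : int) : (q.-1%:Z %| n)%Z = (3 * k%:Z %| n)%Z.
Proof. by rewrite qk. Qed.

(** If k does not divide n, all four Gauss sums have absolute value q^(1/2).
    Otherwise g(3n) = -1 and exactly one of the three factors of the left-hand
    side is -1; both sides then have absolute value q. *)
Lemma norm_triple (n : int) : triple n * ((triple n)^*)%R = tripled n * ((tripled n)^*)%R.
Proof.
rewrite /triple /tripled !rmorphM /= conj_chi // rmorph_nat opprK.
have chi27 : chi 27 ^ (- n) * chi 27 ^ n = 1.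
  by rewrite -expfzDr ?chi_neq0 // addNr.
transitivity ((g n * ((g n)^*)%R) * (g (n + k%:Z) * ((g (n + k%:Z))^*)%R)
  * (g (n + 2 * k%:Z) * ((g (n + 2 * k%:Z))^*)%R)); first by rewrite /=; ring.
transitivity (q%:R ^+ 2 * (g (3 * n) * ((g (3 * n))^*)%R)); last first.
  by rewrite -[LHS]mulr1 -chi27; ring.
rewrite !gauss_norm !dvd3k.
have k0 := third_gt0.
have [/dvdzP [j n_jk]|n_k] := boolP (k%:Z %| n)%Z.
  have -> : (3 * k%:Z %| 3 * n)%Z by rewrite n_jk; apply/dvdzP; exists j; lia.
  have cases : exists i, [\/ n = i * (3 * k%:Z), n = i * (3 * k%:Z) + k%:Z
                          | n = i * (3 * k%:Z) + 2 * k%:Z].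
    have := modz_ge0 j (isT : 3 != 0 :> int); have := ltz_pmod j (isT : 0 < 3 :> int).
    move: (divz_eq j 3) n_jk; move: (j %% 3)%Z (j %/ 3)%Z => r i -> -> r3 r0.
    exists i.
    have [->|[->|->]] : r = 0 \/ r = 1 \/ r = 2 by lia.
    - by constructor 1; ring.
    - by constructor 2; ring.
    - by constructor 3; ring.
  have no_third i : ((3 * k%:Z %| i * (3 * k%:Z) + k%:Z)%Z = false) *
                    ((3 * k%:Z %| i * (3 * k%:Z) + 2 * k%:Z)%Z = false).
    split; apply/negP => /dvdzP [i' e].
      have : k%:Z * (3 * (i' - i) - 1) = 0 by lia.
      by move/eqP; rewrite mulf_eq0; lia.
    have : k%:Z * (3 * (i' - i) - 2) = 0 by lia.
    by move/eqP; rewrite mulf_eq0; lia.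
  have dvd_next i : (3 * k%:Z %| i * (3 * k%:Z) + 3 * k%:Z)%Z.
    by apply/dvdzP; exists (i + 1); ring.
  case: cases => i [] ->; rewrite -?[_ + k%:Z + 2 * _]addrA -?[_ + 2 * _ + k%:Z]addrA.
  - by rewrite !no_third dvdz_mull //; ring.
  - have -> : k%:Z + 2 * k%:Z = 3 * k%:Z by ring.
    have -> : i * (3 * k%:Z) + k%:Z + k%:Z = i * (3 * k%:Z) + 2 * k%:Z by ring.
    by rewrite !no_third dvd_next; ring.
  have -> : 2 * k%:Z + k%:Z = 3 * k%:Z by ring.
  have -> : i * (3 * k%:Z) + 2 * k%:Z + 2 * k%:Z = (i + 1) * (3 * k%:Z) + k%:Z by ring.
  by rewrite !no_third dvd_next; ring.
have not_dvd (x c d : int) : x = c * n + d * k%:Z -> (c = 1) -> (3 * k%:Z %| x)%Z = false.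
  move=> -> ->; apply: contraNF n_k => /dvdzP [i e].
  by apply/dvdzP; exists (3 * i - d); lia.
rewrite (not_dvd n 1 0) ?(not_dvd (n + k%:Z) 1 1) ?(not_dvd (n + 2 * k%:Z) 1 2) //; try by ring.
rewrite ifN; first by rewrite /=; ring.
apply: contra n_k => /dvdzP [i e].
by apply/dvdzP; exists i; lia.
Qed.

(** Both sides have the same absolute value, so the sum of the squared distances
    between them over all residues vanishes once the cross terms are known; the
    cross terms form the twisted sum over the nodal curve. *)
Lemma hasse_davenport_cubic (n : int) :
  g n * g (n + k%:Z) * g (n + 2 * k%:Z) = q%:R * chi 27 ^ (- n) * g (3 * n).
Proof.
pose S : C := q%:R * (q%:R * (q%:R - 1) * (q%:R - 3)).
have conjS : (S^*)%R = S.
  by rewrite /S !rmorphM /= !rmorphB /= !rmorph_nat rmorph1.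
have cross : \sum_(m < q.-1) triple (- m%:Z) * ((tripled (- m%:Z))^*)%R = S.
  have := curve_sum_gauss k%:Z n27 (oner_neq0 F).
  rewrite curve_sum_nodal dvd3k ifN ?addr0; last first.
    apply/negP => /dvdzP [i e]; have k0 := third_gt0.
    have : k%:Z * (3 * i - 1) = 0 by lia.
    by move/eqP; rewrite mulf_eq0; lia.
  rewrite /S => ->; rewrite mulr_sumr; apply: eq_bigr => m _.
  rewrite /triple /tripled !rmorphM /= conj_chi // conj_gauss rmorph_nat.
  rewrite (@gauss_periodic (- m%:Z - k%:Z) (- m%:Z + 2 * k%:Z)); last first.
    by rewrite dvd3k; apply/dvdzP; exists (-1); ring.
  have -> : chi (- 1 / 27) ^ m%:Z = chi (-1) ^ (3 * - m%:Z) * chi 27 ^ (- m%:Z).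
    rewrite chiM ?invr_neq0 // chiV // expfzMl exprz_inv; congr (_ * _).
    by rewrite -(chiN1_even _ (2 * m%:Z)); congr (_ ^ _); ring.
  by rewrite opprK (addrC k%:Z) mulrN opprK; ring.
have norms : \sum_(m < q.-1) tripled (- m%:Z) * ((tripled (- m%:Z))^*)%R = S.
  rewrite (eq_bigr (fun m : 'I_(q.-1) => q%:R ^+ 2 *
      (q%:R - (if (q.-1 %| 3 * m)%N then q%:R - 1 else 0)))) => [|m _]; last first.
    rewrite /tripled !rmorphM /= conj_chi // rmorph_nat.
    transitivity (q%:R ^+ 2 * (chi 27 ^ (- - m%:Z) * chi 27 ^ (- - - m%:Z))
        * (g (3 * - m%:Z) * ((g (3 * - m%:Z))^*)%R)); first by ring.
    rewrite -expfzDr ?chi_neq0 // addrN expr0z mulr1 gauss_norm.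
    by rewrite mulrN !dvdzE abszN /=; case: ifP => _; congr (_ * _); ring.
  rewrite -mulr_sumr sumrB sumr_const card_ord -[q%:R *+ q.-1]mulr_natr.
  rewrite natr_card_pred -big_mkcond /=.
  have -> : \sum_(m < q.-1 | (q.-1 %| 3 * m)%N) (q%:R - 1) = (q%:R - 1) * 3 :> C.
    rewrite -[in LHS](mulr1 (q%:R - 1)) -mulr_sumr; congr (_ * _).
    by rewrite qk (sum_multiples_third (fun=> 1)) ?third_gt0 //; ring.
  by rewrite /S; ring.
have vanish : \sum_(m < q.-1) `|triple (- m%:Z) - tripled (- m%:Z)| ^+ 2 = 0.
  transitivity (\sum_(m < q.-1) (tripled (- m%:Z) * ((tripled (- m%:Z))^*)%R *+ 2
    - triple (- m%:Z) * ((tripled (- m%:Z))^*)%R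
    - (triple (- m%:Z) * ((tripled (- m%:Z))^*)%R)^*)%R).
    by apply: eq_bigr => m _; apply: sqr_norm_sub; apply: norm_triple.
  by rewrite !sumrB sumrMnl -rmorph_sum cross norms /= conjS; ring.
have at_residue (m : 'I_(q.-1)) : triple (- m%:Z) = tripled (- m%:Z).
  have := psumr_eq0P _ vanish => /(_ (fun i _ => exprn_ge0 2 (normr_ge0 _))) /(_ m isT).
  by move/eqP; rewrite expf_eq0 normr_eq0 subr_eq0 => /eqP.
(* Every integer is congruent to -m for one of the residues m of the sum. *)
have lt_res : (`|((- n) %% q.-1)%Z| < q.-1)%N.
  have := ltz_mod (- n) (lt0r_neq0 (card_pred_gt0 : 0 < q.-1%:Z)).
  have := modz_ge0 (- n) (lt0r_neq0 (card_pred_gt0 : 0 < q.-1%:Z)).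
  by lia.
have [m nm] : exists m : 'I_(q.-1), (q.-1%:Z %| n - - m%:Z)%Z.
  exists (Ordinal lt_res); rewrite /= gez0_abs ?modz_ge0 //; last first.
    exact: lt0r_neq0 (card_pred_gt0 : 0 < q.-1%:Z).
  rewrite opprK; apply/dvdzP; exists (- (- n %/ q.-1)%Z).
  transitivity (- - n + (- n %% q.-1)%Z); first by rewrite opprK.
  by rewrite {1}(divz_eq (- n) q.-1%:Z); ring.
have := at_residue m; rewrite /triple /tripled.
rewrite (gauss_periodic nm).
have shift d : (q.-1%:Z %| n + d - (- m%:Z + d))%Z by rewrite opprD addrACA addrN addr0.
rewrite (gauss_periodic (shift k%:Z)) (gauss_periodic (shift (2 * k%:Z))) => ->.
rewrite (@gauss_periodic (3 * n) (3 * - m%:Z)); last by rewrite -mulrBr dvdz_mull.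
rewrite (@chiz_periodic 27 (- n) (- - m%:Z)) //.
by rewrite -opprD dvdzE abszN -dvdzE.
Qed.

(** * The case q = 1 mod 3 *)

(** The product formula at n = 0. *)
Lemma gauss_thirds : g k%:Z * g (2 * k%:Z) = q%:R.
Proof.
have := hasse_davenport_cubic 0; rewrite mulr0 oppr0 expr0z !add0r mulr1.
rewrite !(gauss_trivial (dvdz0 _)) mulN1r mulrN1 mulNr => /oppr_inj; exact.
Qed.

(** The two formulas agree term by term: for m != 0, g(3m) is proportional to
    g(m) g(m+k) g(m+2k) by the product formula, and g(m) cancels one of the three
    factors g(-m) by reflection. *)
Lemma hyp_sum_one_mod_three (t : F) : t != 0 ->
  hyp_sum psi chi alpha beta t = cubic_gamma_sum t.
Proof.
move=> t0; have k3 : q.-1%:R = (3 * k)%N%:R :> rat by rewrite qk.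
have a1 : q.-1%:R * (1 / 3) = k%:Z%:~R :> rat.
  by rewrite -pmulrn k3 natrM; field.
have a2 : q.-1%:R * (2 / 3) = (2 * k%:Z)%:~R :> rat.
  by rewrite -[(2 * _)%:~R]/((2 * k)%N%:R) k3 !natrM; field.
have b1 : q.-1%:R * 1 = q.-1%:Z%:~R :> rat by rewrite mulr1.
rewrite /hyp_sum ifT; last by rewrite /hyp_integral /= a1 a2 b1 !intr_int.
rewrite /hyp_sum_integral /cubic_gamma_sum; congr (_ * _).
apply: eq_bigr => m _.
rewrite !big_ord_recl big_ord0 /= !(tnth_nth 0) /= a1 a2 b1.
rewrite !intrKfloor.
rewrite (@gauss_periodic (- m%:Z - q.-1%:Z) (- m%:Z)); last first.
  by rewrite addrAC subrr add0r dvdzE abszN.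
rewrite (@gauss_trivial (- q.-1%:Z)); last by rewrite dvdzE abszN.
rewrite sqrrN expr1n mul1r.
have [gk0 g2k0] : g k%:Z != 0 /\ g (2 * k%:Z) != 0.
  by apply/andP; rewrite -negb_or -mulf_eq0 gauss_thirds card_neq0.
transitivity (q%:R^-1 * (g (m%:Z + k%:Z) * g (m%:Z + 2 * k%:Z)) * g (- m%:Z) ^+ 2 * chi t ^ m%:Z).
  rewrite -exprnP -gauss_thirds; field.
  by rewrite gk0 g2k0.
case: eqP => [->|/eqP m0].
  rewrite /= mulr0 oppr0 !add0r gauss_thirds mulVf // !expr0z.
  by rewrite gauss_trivial ?dvdz0 //; ring.
have m_ndvd : (q.-1%:Z %| m%:Z)%Z = false.
  by apply/negbTE; rewrite dvdzE /= dvdn_residue.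
have reflect_m := gaussMN m%:Z; rewrite m_ndvd subr0 in reflect_m.
have HD_m := hasse_davenport_cubic m%:Z.
have -> : chi (- t / 27) ^ m%:Z = chi (-1) ^ m%:Z * chi t ^ m%:Z * chi 27 ^ (- m%:Z).
  have -> : - t / 27 = -1 * t * 27^-1 by rewrite mulN1r.
  by rewrite !chiM ?mulf_neq0 ?invr_neq0 // chiV // !expfzMl exprz_inv.
have sqr1 : chi (-1) ^ m%:Z * chi (-1) ^ m%:Z = 1.
  by rewrite -expfzMl -[chi (-1) * _]/(chi (-1) ^+ 2) chiN1_sqr exp1rz.
transitivity (q%:R^-1 ^+ 2 * chi (-1) ^ m%:Z * chi t ^ m%:Z * g (- m%:Z) ^+ 3
   * (q%:R * chi 27 ^ (- m%:Z) * g (3 * m%:Z))); last by field.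
rewrite -HD_m; transitivity (q%:R^-1 ^+ 2 * chi (-1) ^ m%:Z * chi t ^ m%:Z * g (- m%:Z) ^+ 2
   * (g (m%:Z + k%:Z) * g (m%:Z + 2 * k%:Z)) * (g m%:Z * g (- m%:Z))); last by ring.
rewrite reflect_m.
transitivity (q%:R^-1 * (g (m%:Z + k%:Z) * g (m%:Z + 2 * k%:Z)) * g (- m%:Z) ^+ 2 * chi t ^ m%:Z
  * (chi (-1) ^ m%:Z * chi (-1) ^ m%:Z)); first by rewrite sqr1 mulr1.
by field.
Qed.

(** The product formula turns the Gauss sums into g(-3m) g(3m).  By reflection
    this is q chi^m(-1) for most m, which leads to the detection of u^3 = 1; the
    correction at the m with trivial chi^(3m) counts the cube roots of a cube. *)
Lemma curve_sum_twisted (e : int) (u : F) : u != 0 ->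
  e = k%:Z \/ e = - k%:Z ->
  curve_sum e (u ^+ 3) = (if u ^+ 3 == 1 then q%:R else 0) - 3.
Proof.
move=> u0 ek; have t0 : u ^+ 3 != 0 by rewrite expf_neq0.
have qq0 : q%:R * (q%:R - 1) != 0 :> C by rewrite mulf_neq0.
have qkz : q.-1%:Z = 3 * k%:Z by rewrite qk.
apply: (mulfI qq0); rewrite [LHS]curve_sum_gauss // ifN ?addr0; last first.
  have k0 := third_gt0; rewrite qk; apply/negP => /dvdzP [i ei].
  have [] : k%:Z * (3 * i - 1) = 0 \/ k%:Z * (3 * i + 1) = 0 by case: ek; lia.
    by move/eqP; rewrite mulf_eq0; lia.
  by move/eqP; rewrite mulf_eq0; lia.
transitivity (\sum_(m < q.-1) q%:R * (q%:R * chi (u ^+ 3) ^ m%:Z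
   - (if (q.-1 %| 3 * m)%N then (q%:R - 1) * chi ((- u ^+ 3)^-1) ^ (- m%:Z) else 0))).
  apply: eq_bigr => m _.
  have -> : g (e - m%:Z) * g (- m%:Z) * g (- m%:Z - e) =
            g (- m%:Z) * g (- m%:Z + k%:Z) * g (- m%:Z + 2 * k%:Z).
    have per : g (- m%:Z - k%:Z) = g (- m%:Z + 2 * k%:Z).
      by apply: gauss_periodic; apply/dvdzP; exists (-1); rewrite qkz; ring.
    by case: ek => ->; rewrite -per ?opprK addrC; ring.
  rewrite hasse_davenport_cubic opprK.
  have -> : chi (- u ^+ 3 / 27) ^ m%:Z = chi (- u ^+ 3) ^ m%:Z * chi 27 ^ (- m%:Z).
    by rewrite chiM ?invr_neq0 ?oppr_eq0 // chiV // expfzMl exprz_inv.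
  have chi27 : chi 27 ^ m%:Z * chi 27 ^ (- m%:Z) = 1.
    by rewrite -expfzDr ?chi_neq0 // subrr.
  transitivity (q%:R * chi (- u ^+ 3) ^ m%:Z * (g (3 * m%:Z) * g (- (3 * m%:Z)))).
    by rewrite -[RHS]mulr1 -chi27 mulrN; ring.
  rewrite gaussMN -[LHS]mulrA; congr (_ * _); rewrite mulrBr; congr (_ - _).
    rewrite mulrCA (_ : 3 * m%:Z = m%:Z + 2 * m%:Z) ?chiN1_even; last by ring.
    by congr (_ * _); rewrite -expfzMl -chiM ?oppr_eq0 ?oner_neq0 // mulrN1 opprK.
  rewrite dvdzE /= chiV ?oppr_eq0 // exprz_inv opprK.
  by case: ifP => _; rewrite ?mulr0 // mulrC.
rewrite -mulr_sumr sumrB -mulr_sumr sum_chi_exponents // -big_mkcond -mulr_sumr /=.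
rewrite -cube_root_count ?invr_neq0 ?oppr_eq0 //.
have -> : (- u ^+ 3)^-1 = (- u)^-1 ^+ 3 by rewrite exprVn; congr (_^-1); ring.
rewrite cube_root_count_cube ?invr_neq0 ?oppr_eq0 //.
by case: ifP => _; ring.
Qed.

Lemma card_hesse_points_one_mod_three (u : F) : u != 0 ->
  #|hesse_points u|%:R =
  q%:R + 1 - cubic_gamma_sum (u ^+ 3) + 2 * (if u ^+ 3 == 1 then q%:R else 0) :> C.
Proof.
move=> u0; have t0 : u ^+ 3 != 0 by rewrite expf_neq0.
rewrite card_hesse_points natrD natrM hesse_torus_count //.
have -> : #|[pred a : F | a ^+ 3 == -1]| = 3%N.
  have cubeN1 : (-1) ^+ 3 = -1 :> F by ring.
  by rewrite -[RHS](cube_root_count_cube N10) cubeN1.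
transitivity (curve_sum 0 (u ^+ 3) + curve_sum (- k%:Z) (u ^+ 3)
              + curve_sum k%:Z (u ^+ 3) + 3 * 3 : C).
  congr (_ + _); rewrite natr_sum /curve_sum -!big_split.
  apply: eq_bigr => x x0; rewrite natr_sum -!big_split; apply: eq_bigr => y _.
  by rewrite cube_root_count_third // expr0z.
rewrite curve_sum_untwisted // !curve_sum_twisted //; [|by left|by right].
ring.
Qed.

End OneModThree.

End Characters.

Theorem theorem1p10 (R : realType) (F : finFieldType) (psi chi : F -> R[i])
    (hpsi : nontrivial_add_char psi)
    (hchi : mult_char chi) (ordchi : mult_char_order chi #|F|.-1)
    (u : F) (hu : u != 0) :
  ((#|F| %% 3 = 2)%N ->
    (#|hesse_points u|%:R : R[i]) =
      #|F|%:R + 1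
      - hyp_sum psi chi [tuple 1 / 3; 2 / 3] [tuple 1; 1] (u ^+ 3))
  /\
  ((#|F| %% 3 = 1)%N ->
    (#|hesse_points u|%:R : R[i]) =
      #|F|%:R + 1
      - hyp_sum psi chi [tuple 1 / 3; 2 / 3] [tuple 1; 1] (u ^+ 3)
      - 2 * #|F|%:R * hyp_sum psi chi [tuple] [tuple] (u ^+ 3)
    /\
    #|F|%:R + 1
      - hyp_sum psi chi [tuple 1 / 3; 2 / 3] [tuple 1; 1] (u ^+ 3)
      - 2 * #|F|%:R * hyp_sum psi chi [tuple] [tuple] (u ^+ 3)
    = #|F|%:R + 1
      - hyp_sum psi chi [tuple 1 / 3; 2 / 3] [tuple 1; 1] (u ^+ 3)
      - 2 * #|F|%:R * (if u ^+ 3 == 1 then -1 else 0)).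
Proof.
have t0 : u ^+ 3 != 0 by rewrite expf_neq0.
split=> q3.
  by rewrite (hyp_sum_two_mod_three hpsi hchi ordchi) // -card_hesse_points_two_mod_three.
have qk : #|F|.-1 = (3 * (#|F| %/ 3))%N.
  by rewrite {1}(divn_eq #|F| 3) q3 addn1 mulnC.
rewrite (hyp_sum_empty psi hchi ordchi t0); split=> //.
rewrite (hyp_sum_one_mod_three hpsi hchi ordchi qk t0).
rewrite (card_hesse_points_one_mod_three hpsi hchi ordchi qk hu).
by case: ifP => _; ring.
Qed.
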